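(* Let $r\ge 1$ and $s\ge 1$ be integers. (i) (Alternating case.) For each fixed $r\geq 1$, the probability that a random alternating $(r,2s-1)$-meander link is nontrivial (i.e. is not an unlink) tends to $1$ as $s\to\infty$. (ii) (Random crossings.) The probability that a random $(r,2s-1)$-meander link (with crossing information chosen uniformly at random) is nontrivial tends to $1$ as both $s$ and $r$ tend to infinity.
   Context: A $p$-string of length $s$ is a correctly matched (balanced) string of $s$ left and $s$ right parentheses; there are $C_s=\frac{1}{s+1}\binom{2s}{s}$ of them. Given two $p$-strings $U$ (upper) and $W$ (lower) of length $s$, the meander graph $\Gamma_{2s-1}=\Gamma(U,W)$ is the planar graph obtained as follows: mark the points $0,1,\dots,2s$ on the $x$-axis and take the segment $[0,2s]$ (the axis); for each matched pair of parentheses of $U$ at positions $a<b$ (positions numbered $1,\dots,2s$) join the points $a,b$ by a semicircle in the upper half-plane; for each matched pair of $W$ at positions $a<b$ join the points $a-1,b-1$ by a semicircle in the lower half-plane. The points $1,\dots,2s-1$ are the $2s-1$ four-valent vertices. The union of the axis and the semicircles is a union of closed curves; turning each vertex into a crossing (the semicircles passing over or under the axis) gives a meander link diagram. For $r\ge1$, the $(r,2s-1)$-meander graph $\Gamma^r_{2s-1}$ is obtained by replacing every closed curve of this picture by $r$ parallel copies, so each vertex becomes $r^2$ vertices; assigning over/under information to all $(2s-1)r^2$ vertices gives an $(r,2s-1)$-meander link diagram. A random $(r,2s-1)$-meander link is obtained by choosing the pair $(U,W)$ uniformly among the $C_s^2$ pairs of $p$-strings of length $s$ and, independently, the over/under information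 uniformly among all $2^{(2s-1)r^2}$ choices. A random alternating $(r,2s-1)$-meander link is obtained by choosing $(U,W)$ uniformly and then choosing uniformly one of the two crossing assignments making the diagram alternating. *)

(* Defs.v *)
From HB Require Import structures.
From mathcomp Require Import all_boot all_order all_algebra.
From mathcomp Require Import all_classical all_reals all_analysis.
Unset Printing Implicit Defensive.
Import Order.TTheory GRing.Theory Num.Theory.
Import numFieldNormedType.Exports.
Local Open Scope classical_set_scope.
Local Open Scope ring_scope.

(* p-strings.  A word is a seq bool, true = '(' and false = ')'.       *)
(* Positions are numbered 1..size w; position p is  nth false w p.-1. *)

Definition ht (w : seq bool) (t : nat) : int :=
  \sum_(u < t) (if nth false w u then 1 else -1).

Definition pstring (s : nat) (w : seq bool) : bool :=
  [&& size w == s.*2, [forall t : 'I_(s.*2).+1, 0 <= ht w t] & ht w s.*2 == 0].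

(* positions a < b are a matched pair of parentheses of w *)
Definition mpair (w : seq bool) (a b : nat) : bool :=
  [&& (0 < a)%N, (a < b)%N, (b <= size w)%N, nth false w a.-1,
      ht w b == ht w a.-1 &
      [forall t : 'I_b, (a <= t)%N ==> (ht w a.-1 < ht w t)]].

(* Geometric realisation in R^3 of the (r,2s-1)-meander link diagram  *)
(* Gamma^r(U,W) with crossing information O.                           *)
(*   O k i j (1 <= k <= 2s-1, i,j < r) is the crossing between the     *)
(*   i-th parallel copy (bottom to top) of the axis and the j-th        *)
(*   parallel copy (left to right) of the strand crossing the axis at  *)
(*   the point k;  O k i j = true  iff the axis copy passes OVER.       *)
(* Semicircles are drawn as rectangular arcs (isotopic in the plane);  *)
(* r parallel copies are nested offsets by multiples of dd r; at each  *)
(* crossing the under-strand dips below the plane z = 0.               *)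

Definition seg (R : realType) (p q : R * R * R) : set (R * R * R) :=
  [set x | exists2 t : R, 0 <= t <= 1 &
     x = (p.1.1 + t * (q.1.1 - p.1.1), p.1.2 + t * (q.1.2 - p.1.2),
          p.2 + t * (q.2 - p.2))].

Definition poly3 (R : realType) (p q u v : R * R * R) : set (R * R * R) :=
  seg R p q `|` seg R q u `|` seg R u v.

Definition dd (R : realType) (r : nat) : R := (r.*2)%:R^-1.
Definition cc (R : realType) (r : nat) : R := (r%:R - 1) / 2.
(* x-coordinate of the j-th copy of the strand through the point k *)
Definition xc (R : realType) (r k j : nat) : R := k%:R + (j%:R - cc R r) * dd R r.
(* y-coordinate of the i-th copy of the axis *)
Definition yc (R : realType) (r i : nat) : R := (i%:R - cc R r) * dd R r.
Definition eta (R : realType) (r : nat) : R := dd R r / 4.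
Definition tent (R : realType) (r : nat) (t : R) : R := Num.max 0 (eta R r - `|t|).

Definition zH (R : realType) (s r : nat) (O : nat -> nat -> nat -> bool)
  (i : nat) (x : R) : R :=
  - \sum_(1 <= k < s.*2) \sum_(j < r)
      (if O k i j then 0 else tent R r (x - xc R r k j)).

Definition zV (R : realType) (r : nat) (O : nat -> nat -> nat -> bool)
  (k j : nat) (y : R) : R :=
  - \sum_(i < r) (if O k i j then tent R r (y - yc R r i) else 0).

Definition hstrand (R : realType) (s r : nat) O (i : nat) : set (R * R * R) :=
  [set p | exists2 x : R,
     (cc R r - i%:R) * dd R r <= x <= (s.*2)%:R + (cc R r - i%:R) * dd R r &
     p = (x, yc R r i, zH R s r O i x)].

Definition vstrand (R : realType) (r : nat) O (k j : nat) : set (R * R * R) :=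
  [set p | exists2 y : R, - (1 / 2) <= y <= 1 / 2 &
     p = (xc R r k j, y, zV R r O k j y)].

(* m-th copy (m = 0 outermost) of the upper arc joining the points a < b;
   if b = 2s it turns into the m-th copy of the axis *)
Definition uarc (R : realType) (s r a b m : nat) : set (R * R * R) :=
  let h : R := (b - a)%N%:R + (cc R r - m%:R) * dd R r in
  let x1 := xc R r a m in
  let x2 := xc R r b (r.-1 - m)%N in
  let yend : R := if b == s.*2 then yc R r m else 1 / 2 in
  poly3 R (x1, 1 / 2, 0) (x1, h, 0) (x2, h, 0) (x2, yend, 0).

(* m-th copy (m = 0 outermost) of the lower arc coming from the matched
   pair a < b of W, i.e. joining the points a-1 < b-1; if a = 1 it turns
   into the (r-1-m)-th copy of the axis *)
Definition larc (R : realType) (r a b m : nat) : set (R * R * R) :=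
  let p := a.-1 in
  let q := b.-1 in
  let D : R := - ((q - p)%N%:R + (cc R r - m%:R) * dd R r) in
  let x1 := xc R r p m in
  let x2 := xc R r q (r.-1 - m)%N in
  let ystart : R := if p == 0%N then yc R r (r.-1 - m)%N else - (1 / 2) in
  poly3 R (x1, ystart, 0) (x1, D, 0) (x2, D, 0) (x2, - (1 / 2), 0).

Definition meander_link (R : realType) (s r : nat) (U W : seq bool)
  (O : nat -> nat -> nat -> bool) : set (R * R * R) :=
  (\bigcup_(i in [set i : nat | (i < r)%N]) hstrand R s r O i)
  `|` (\bigcup_(kj in [set kj : nat * nat | (0 < kj.1 < s.*2)%N && (kj.2 < r)%N])
         vstrand R r O kj.1 kj.2)
  `|` (\bigcup_(abm in [set abm : nat * nat * nat |
                         mpair U abm.1.1 abm.1.2 && (abm.2 < r)%N])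
         uarc R s r abm.1.1 abm.1.2 abm.2)
  `|` (\bigcup_(abm in [set abm : nat * nat * nat |
                         mpair W abm.1.1 abm.1.2 && (abm.2 < r)%N])
         larc R r abm.1.1 abm.1.2 abm.2).

Definition unlink_std (R : realType) (n : nat) : set (R * R * R) :=
  [set p | exists2 k : nat, (k < n)%N &
     (p.1.1 - 3 * k%:R) ^+ 2 + p.1.2 ^+ 2 = 1 /\ p.2 = 0].

Definition is_unlink (R : realType) (L : set (R * R * R)) : Prop :=
  exists (n : nat) (f g : R * R * R -> R * R * R),
    [/\ continuous f, continuous g, cancel f g, cancel g f &
        f @` L = unlink_std R n].

(* An end of an edge of the projection graph is (k,i,j,h): crossing     *)
(* (k,i,j), strand = axis copy if h = true, crossing strand otherwise.  *)

Definition cend := (nat * nat * nat * bool)%type.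

Definition medge (s r : nat) (U W : seq bool) (e1 e2 : cend) : Prop :=
  let n := s.*2 in
  (* along an axis copy, inside the bundle at point k *)
  (exists k i j, [/\ (0 < k < n)%N, (i < r)%N, (j.+1 < r)%N,
                     e1 = (k, i, j, true) & e2 = (k, i, j.+1, true)]) \/
  (* along an axis copy, from the bundle at k to the bundle at k+1 *)
  (exists k i, [/\ (0 < k)%N, (k.+1 < n)%N, (i < r)%N,
                   e1 = (k, i, r.-1, true) & e2 = (k.+1, i, 0%N, true)]) \/
  (* along a crossing strand, inside the bundle at point k *)
  (exists k i j, [/\ (0 < k < n)%N, (i.+1 < r)%N, (j < r)%N,
                     e1 = (k, i, j, false) & e2 = (k, i.+1, j, false)]) \/
  (* copies of an upper arc joining a < b < 2s *)
  (exists a b m, [/\ mpair U a b, (b < n)%N, (m < r)%N,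
                     e1 = (a, r.-1, m, false) & e2 = (b, r.-1, (r.-1 - m)%N, false)]) \/
  (* copies of the upper arc joining a and 2s, continuing along the axis *)
  (exists a m, [/\ mpair U a n, (m < r)%N,
                   e1 = (a, r.-1, m, false) & e2 = (n.-1, m, r.-1, true)]) \/
  (* copies of a lower arc joining the points a-1 > 0 and b-1 *)
  (exists a b m, [/\ mpair W a b, (1 < a)%N, (m < r)%N,
                     e1 = (a.-1, 0%N, m, false) & e2 = (b.-1, 0%N, (r.-1 - m)%N, false)]) \/
  (* copies of the lower arc joining the point 0 and b-1, continuing along the axis *)
  (exists b i, [/\ mpair W 1 b, (i < r)%N,
                   e1 = (1%N, i, 0%N, true) & e2 = (b.-1, 0%N, i, false)]).

Definition over_end (O : nat -> nat -> nat -> bool) (e : cend) : bool :=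
  let '(k, i, j, h) := e in if h then O k i j else ~~ O k i j.

Definition alternating (s r : nat) (U W : seq bool)
  (O : nat -> nat -> nat -> bool) : Prop :=
  forall e1 e2, medge s r U W e1 e2 -> over_end O e1 != over_end O e2.

(* crossing information: one bit for each of the (2s-1) r^2 crossings;
   index (k', i, j) stands for the crossing (k'+1, i, j) *)
Definition xinfo (s r : nat) := {ffun 'I_(s.*2).-1 * 'I_r * 'I_r -> bool}.

Definition ofun (s r : nat) (f : xinfo s r) : nat -> nat -> nat -> bool :=
  fun k i j =>
    match (insub k.-1 : option 'I_(s.*2).-1), (insub i : option 'I_r),
          (insub j : option 'I_r) with
    | Some k', Some i', Some j' => (0 < k)%N && f (k', i', j')
    | _, _, _ => false
    end.

Definition nontrivialb (R : realType) (s r : nat) (U W : seq bool) (f : xinfo s r)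
  : bool := `[< ~ is_unlink R (meander_link R s r U W (ofun s r f)) >].

Definition alternatingb (s r : nat) (U W : seq bool) (f : xinfo s r) : bool :=
  `[< alternating s r U W (ofun s r f) >].

Definition prob_random (R : realType) (r s : nat) : R :=
  (\sum_(U : (s.*2).-tuple bool | pstring s U)
     \sum_(W : (s.*2).-tuple bool | pstring s W)
       #|[set f : xinfo s r | nontrivialb R s r U W f]|%:R)
  / (\sum_(U : (s.*2).-tuple bool | pstring s U)
       \sum_(W : (s.*2).-tuple bool | pstring s W)
         #|[set: xinfo s r]|%:R).

(* probability that a random alternating (r,2s-1)-meander link is nontrivial:
   (U,W) uniform, then the crossing information uniform among the
   alternating ones *)
Definition prob_alt (R : realType) (r s : nat) : R :=
  (\sum_(U : (s.*2).-tuple bool | pstring s U)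
     \sum_(W : (s.*2).-tuple bool | pstring s W)
       (#|[set f : xinfo s r | alternatingb s r U W f && nontrivialb R s r U W f]|%:R
        / #|[set f : xinfo s r | alternatingb s r U W f]|%:R))
  / (\sum_(U : (s.*2).-tuple bool | pstring s U)
       \sum_(W : (s.*2).-tuple bool | pstring s W) 1).

(* Main.v *)
(** If U matches the points a, a+1 and W matches the points a, a+1 as well, the link contains r
    nested circles clasping the r parallel copies of the axis at a and a+1.  When the m-th of these
    circles passes under and then over the first axis copy (or conversely), it has linking number
    +-1 with the component K containing that copy, and the link is not an unlink.  Concretely, let
    (u, v) be a map from R^3 to the plane vanishing on the clasping circle only; along K, the
    first coordinate u is negative exactly on the stretch of axis inside the circle, and v has
    opposite signs at its ends.  In an unlink K would bound a disc missing the clasping circle, so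
    (u, v) would extend to a nonvanishing map on a disc, which a parity count of label changes on a
    fine grid (as in Sperner's lemma) excludes.  That K passes through the circle only once
    holds because the r parallel copies of the axis lie on different components.

    An alternating diagram always has such crossings, and a random one fails to have them on all r
    circles with probability 2^-r.  Pairs of words without a clasp in any of their windows
    of length 3 are at most 63^(2s/3) * 16, exponentially fewer than the 16^s pairs of words, while
    there are at least 4^s / (2s+1)^2 p-strings. *)
Require Import Defs.
From HB Require Import structures.
From mathcomp Require Import all_boot all_order all_algebra.
From mathcomp Require Import zify ring lra.
From mathcomp Require Import all_classical all_reals all_analysis.
Set Implicit Arguments.
Unset Strict Implicit.
Unset Printing Implicit Defensive.
Import Order.TTheory GRing.Theory Num.Theory.
Import numFieldNormedType.Exports.
Local Open Scope classical_set_scope.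
Local Open Scope ring_scope.

(** * Winding numbers modulo 2 *)

(* A vertex of the grid carries a label [(p, q)] recording the truth of u >= 0 and v > 0;
   [lab_change] detects an edge along which v changes sign while u stays nonnegative. *)
Definition lab_change (x y : bool * bool) : bool := [&& x.1, y.1 & x.2 != y.2].

Lemma lab_change_row (lab : nat -> bool * bool) (m : nat) :
  (forall j, (j <= m)%N -> (lab j).1) ->
  \big[addb/false]_(j < m) lab_change (lab j) (lab j.+1) = ((lab 0%N).2 != (lab m).2).
Proof.
elim: m => [|m IH] h; first by rewrite big_ord0 eqxx.
rewrite big_ord_recr /= IH; last by move=> j jm; apply: h; lia.
rewrite /lab_change !h //.
by case: (lab 0%N).2; case: (lab m).2; case: (lab m.+1).2.
Qed.

(** The changes along the four sides of a cell cancel modulo 2: there are none if the second label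
    is constant, and if the first is constant they are the sign changes around a cycle, or none.
    Summing over a strip leaves its two end edges, which periodicity identifies. *)
Lemma grid_parity (lab : nat -> nat -> bool * bool) (n m : nat) :
  (forall i j, (i < n)%N -> (j < m)%N ->
     (forall x, x \in [:: (lab i j).1; (lab i.+1 j).1; (lab i j.+1).1; (lab i.+1 j.+1).1] ->
        x = (lab i j).1) \/
     (forall x, x \in [:: (lab i j).2; (lab i.+1 j).2; (lab i j.+1).2; (lab i.+1 j.+1).2] ->
        x = (lab i j).2)) ->
  (forall i, (i <= n)%N -> lab i 0%N = lab i m) ->
  \big[addb/false]_(j < m) lab_change (lab n j) (lab n j.+1) =
  \big[addb/false]_(j < m) lab_change (lab 0%N j) (lab 0%N j.+1).
Proof.
elim: n => [//|n IH] cell per.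
rewrite -IH; first last.
- by move=> i ni; apply: per; lia.
- by move=> i j ni; apply: cell; lia.
have key k : (k <= m)%N ->
    \big[addb/false]_(j < k) lab_change (lab n.+1 j) (lab n.+1 j.+1)
    = \big[addb/false]_(j < k) lab_change (lab n j) (lab n j.+1)
      (+) (lab_change (lab n 0%N) (lab n.+1 0%N) (+) lab_change (lab n k) (lab n.+1 k)).
  elim: k => [|k IHk] km; first by rewrite !big_ord0 addbb.
  rewrite !big_ord_recr /= IHk; last by lia.
  rewrite -!addbA; congr addb; rewrite ![_ (+) (lab_change (lab n 0%N) _ (+) _)]addbCA.
  congr addb.
  have := cell n k (ltnSn n) km; rewrite /lab_change.
  move: (lab n k) (lab n.+1 k) (lab n k.+1) (lab n.+1 k.+1) => [a a'] [b b'] [c c'] [d d'] /=.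
  case=> h.
  - have := h b; have := h c; have := h d; rewrite !inE !eqxx !orbT /=.
    move=> /(_ isT) -> /(_ isT) -> /(_ isT) ->.
    by case: a {h}; case: a'; case: b'; case: c'; case: d'.
  - have := h b'; have := h c'; have := h d'; rewrite !inE !eqxx !orbT /=.
    move=> /(_ isT) -> /(_ isT) -> /(_ isT) ->.
    by rewrite !eqxx !andbF.
by rewrite key // -!per // addbb addbF.
Qed.

(** A Lebesgue number argument: near each point one of [u], [v] keeps its sign by continuity, and
    compactness of the square makes the radius uniform. *)
Lemma locally_signed (R : realType) (u v : R * R -> R) :
  continuous u -> continuous v ->
  (forall x y : R, 0 <= x <= 1 -> 0 <= y <= 1 -> ~ (u (x, y) = 0 /\ v (x, y) = 0)) ->
  exists2 d : R, 0 < d & forall p : R * R, 0 <= p.1 <= 1 -> 0 <= p.2 <= 1 ->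
    (forall q, ball p d q -> 0 < u q * u p) \/ (forall q, ball p d q -> 0 < v q * v p).
Proof.
move=> cu cv nz.
have K : compact (`[0, 1]%classic `*` `[0, 1]%classic : set (R * R)).
  by apply: compact_setX; exact: segment_compact.
pose P (d : R) (p : R * R) :=
  (forall q, ball p d q -> 0 < u q * u p) \/ (forall q, ball p d q -> 0 < v q * v p).
have sgn (w : R * R -> R) (p : R * R) : continuous w -> w p != 0 ->
    exists2 e : R, 0 < e & forall q, ball p e q -> 0 < w q * w p.
  move=> cw wp.
  have : \forall q \near p, 0 < w q * w p.
    have c : {for p, continuous (fun q => w q * w p)}.
      by apply: continuousM; [exact: cw | exact: cvg_cst].
    have wp2 : 0 < w p * w p by rewrite -expr2 exprn_even_gt0.
    exact: (cvgr_gt _ c _ wp2).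
  by move=> /nbhs_ballP[e /= e0 h]; exists e.
have : \forall d \near (0 : R)^'+, forall p, (`[0, 1]%classic `*` `[0, 1]%classic) p -> P d p.
  have nc := compact_near_coveringP (`[0, 1]%classic `*` `[0, 1]%classic : set (R * R)).
  apply: (nc.1 K R (0^'+) P) => // -[x y] /= [xI yI].
  have : u (x, y) != 0 \/ v (x, y) != 0.
    apply: contrapT => /not_orP[/negP + /negP]; rewrite !negbK => /eqP u0 /eqP v0.
    by apply: (nz x y) => //; move: xI yI; rewrite !in_itv.
  have loc (w : R * R -> R) : continuous w -> w (x, y) != 0 ->
     \forall p \near (x, y) & d \near 0^'+, forall q, ball p d q -> 0 < w q * w p.
    move=> cw /(sgn _ _ cw)[e e0 he].
    (* Half the radius for both [p] and [d], so that the [d]-ball about [p] stays in the [e]-ball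
       about [(x, y)]. *)
    exists (ball (x, y) (e / 2), [set d : R | 0 < d < e / 2]).
      split => /=; first by apply: nbhsx_ballx; rewrite divr_gt0.
      have z0 : \forall z \near (0 : R)^'+, 0 < z by exact: nbhs_right_gt.
      have ze : \forall z \near (0 : R)^'+, z < e / 2.
        by apply: nbhs_right_lt; rewrite divr_gt0.
      by apply: filterS2 z0 ze => z /= -> ->.
    move=> [p d] /= [pe /andP[d0 de]] q pq.
    have e2 : e / 2 <= e by lra.
    have h1 := he p (le_ball e2 pe).
    have h2 : 0 < w q * w (x, y).
      apply: he; rewrite (splitr e); apply: ball_triangle pe _.
      by apply: le_ball pq; exact: ltW.
    have := mulr_gt0 h2 h1.
    have -> : w q * w (x, y) * (w p * w (x, y)) = (w q * w p) * (w (x, y) ^+ 2) by ring.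
    rewrite pmulr_lgt0 // exprn_even_gt0 //=.
    by apply/eqP => w0; move: h1; rewrite w0 mulr0 ltxx.
  case=> /loc h.
    by apply: filterS (h cu) => -[p d] /= hh; left.
  by apply: filterS (h cv) => -[p d] /= hh; right.
move=> h.
have /(_ _)[] // := @filter_ex _ (0 : R)^'+ _ (fun d => 0 < d /\ forall p, (`[0, 1]%classic `*` `[0, 1]%classic) p -> P d p).
  by apply: filterI h; exact: nbhs_right_gt.
move=> d [d0 hd]; exists d => // p p1 p2; apply: hd; split; rewrite /= in_itv /=; [exact: p1|exact: p2].
Qed.

(** The square is a disc in polar coordinates, [x] the radius and [y] the angle. The parity of label
    changes is even at the centre, where labels are constant, and odd on the boundary: [u < 0]
    excludes changes on the first half, and [v] has opposite signs at the ends of the second. By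
    [grid_parity] the two would agree. *)
Lemma no_null_loop (R : realType) (u v : R * R -> R) :
  continuous u -> continuous v ->
  (forall x y : R, 0 <= x <= 1 -> 0 <= y <= 1 -> ~ (u (x, y) = 0 /\ v (x, y) = 0)) ->
  (forall y : R, u (0, y) = u (0, 0) /\ v (0, y) = v (0, 0)) ->
  (forall x : R, u (x, 0) = u (x, 1) /\ v (x, 0) = v (x, 1)) ->
  u (1, 0) = 0 -> u (1, 1 / 2) = 0 -> v (1, 0) * v (1, 1 / 2) < 0 ->
  (forall y : R, 0 < y < 1 / 2 -> u (1, y) < 0) ->
  (forall y : R, 1 / 2 < y < 1 -> 0 < u (1, y)) -> False.
Proof.
move=> cu cv nz c0 per u10 u11 v10 uneg upos.
have [d d0 hd] := locally_signed cu cv nz.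
(* Having [n >= 2] puts the left end of the edge that ends at the midpoint strictly between 0 and
   1/2, where [u < 0]; at the midpoint itself [u] is 0 and is labelled nonnegative. *)
pose n := (Num.truncn d^-1).+2.
have nd : n%:R^-1 < d.
  rewrite invf_plt ?posrE //; apply: lt_le_trans (truncnS_gt _) _.
  by rewrite ler_nat /n.
(* An even number of steps makes 1/2 a grid point. *)
pose N := (n + n)%N.
have N0 : (0 : R) < N%:R by rewrite ltr0n.
pose g (i : nat) : R := i%:R / N%:R.
have g01 i : (i <= N)%N -> 0 <= g i <= 1.
  move=> iN; rewrite /g divr_ge0 //=.
  by rewrite ler_pdivrMr // mul1r ler_nat.
have g0 : g 0%N = 0 by rewrite /g mul0r.
have gN : g N = 1 by rewrite /g divff // gt_eqF.
have gn : g n = 1 / 2.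
  rewrite /g /N natrD; have : (0 : R) < n%:R by rewrite ltr0n.
  by move=> ?; field; rewrite gt_eqF //; lra.
have glt i j : (i < j)%N -> g i < g j.
  by move=> ij; rewrite /g ltr_pM2r ?invr_gt0 // ltr_nat.
have gS i : `|g i - g i.+1| < d.
  rewrite /g -mulrBl -natr1 opprD addNKr mulN1r normrN gtr0_norm ?invr_gt0 //.
  apply: le_lt_trans nd; rewrite lef_pV2 ?posrE ?ltr0n //.
  by rewrite ler_nat /N; lia.
pose lab (i j : nat) : bool * bool := (0 <= u (g i, g j), 0 < v (g i, g j)).
suff : \big[addb/false]_(j < N) lab_change (lab N j) (lab N j.+1) =
    \big[addb/false]_(j < N) lab_change (lab 0%N j) (lab 0%N j.+1).
  have -> : \big[addb/false]_(j < N) lab_change (lab 0%N j) (lab 0%N j.+1) = false.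
    apply: big1 => j _; rewrite /lab_change /lab /= g0.
    have [-> ->] := c0 (g j); have [-> ->] := c0 (g j.+1).
    by rewrite eqxx !andbF.
  have -> : \big[addb/false]_(j < N) lab_change (lab N j) (lab N j.+1) = true.
    rewrite /N big_split_ord /= -/N big1 => [|j _].
      rewrite addFb.
      have -> : \big[addb/false]_(i < n) lab_change (lab N (n + i)%N) (lab N (n + i).+1)
         = \big[addb/false]_(i < n) lab_change (lab N (n + i)%N) (lab N (n + i.+1)%N).
        by apply: eq_bigr => i _; rewrite addnS.
      rewrite (@lab_change_row (fun j => lab N (n + j)%N)).
        rewrite addn0 /lab /= -/N gn gN.
        have [_ <-] := per 1.
        case: (ltrgtP (v (1, 0)) 0) v10 => [a|a|->]; last by rewrite mul0r ltxx.
        - by rewrite nmulr_rlt0 // => ->.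
        - by rewrite pmulr_rlt0 // => b; rewrite ltNge (ltW b).
      move=> j jn; rewrite /lab /= gN.
      have [->|j0] := posnP j; first by rewrite addn0 gn u11.
      have [->|jn'] := eqVneq j n; first by rewrite -/N gN; have [<- _] := per 1; rewrite u10.
      apply/ltW/upos/andP; split.
        by rewrite -gn; apply: glt; rewrite -{1}[n]addn0 ltn_add2l.
      by rewrite -gN; apply: glt; rewrite /N ltn_add2l ltn_neqAle jn' jn.
    rewrite /lab_change /lab /= gN.
    have [jn|jn] := eqVneq j.+1 n.
      rewrite [0 <= u (1, g j)]leNgt uneg //.
      rewrite -{1}g0 -gn !glt //; by move: jn; case: (nat_of_ord j).
    rewrite [0 <= u (1, g j.+1)]leNgt uneg ?andbF //.
    rewrite -{1}g0 -gn !glt //.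
    by rewrite ltn_neqAle jn /= ltn_ord.
  by [].
apply: grid_parity; last first.
- move=> i iN; rewrite /lab g0 gN.
  by have [<- <-] := per (g i).
- move=> i j iN jN.
  have bb x y : `|g i - x| < d -> `|g j - y| < d -> ball (g i, g j) d (x, y).
    by move=> ? ?; split.
  have b0 k : `|g k - g k| < d by rewrite subrr normr0.
  have sgn (a b : R) : 0 < a * b -> ((0 <= a) = (0 <= b)) * ((0 < a) = (0 < b)).
    move=> ab; case: (ltrgtP a 0) ab => [a0|a0|->]; last by rewrite mul0r ltxx.
    - by rewrite nmulr_rgt0 // => b0'; rewrite [0 < b]ltNge [0 <= b]leNgt b0' (ltW b0').
    - by rewrite pmulr_rgt0 // => b0'; rewrite b0' ltW.
  have [h|h] := hd (g i, g j) (g01 _ (ltnW iN)) (g01 _ (ltnW jN)); [left|right] => x;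
    rewrite !inE => /or4P[] /eqP -> //=.
  + by have [-> _] := sgn _ _ (h _ (bb _ _ (gS i) (b0 j))).
  + by have [-> _] := sgn _ _ (h _ (bb _ _ (b0 i) (gS j))).
  + by have [-> _] := sgn _ _ (h _ (bb _ _ (gS i) (gS j))).
  + by have [_ ->] := sgn _ _ (h _ (bb _ _ (gS i) (b0 j))).
  + by have [_ ->] := sgn _ _ (h _ (bb _ _ (b0 i) (gS j))).
  + by have [_ ->] := sgn _ _ (h _ (bb _ _ (gS i) (gS j))).
Qed.

(** * Continuity and paths *)

Lemma contM (R : realType) (T : topologicalType) (f g : T -> R) :
  continuous f -> continuous g -> continuous (fun x => f x * g x).
Proof. by move=> cf cg x; apply: cvgM; [exact: cf | exact: cg]. Qed.

Lemma contD (R : realType) (T : topologicalType) (f g : T -> R) :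
  continuous f -> continuous g -> continuous (fun x => f x + g x).
Proof. by move=> cf cg x; apply: cvgD; [exact: cf | exact: cg]. Qed.

Lemma contN (R : realType) (T : topologicalType) (f : T -> R) :
  continuous f -> continuous (fun x => - f x).
Proof. by move=> cf x; apply: cvgN; exact: cf. Qed.

Lemma contX (R : realType) (T : topologicalType) (f : T -> R) n :
  continuous f -> continuous (fun x => f x ^+ n).
Proof.
move=> cf; elim: n => [|n IH]; first by move=> x; exact: cvg_cst.
have -> : (fun x => f x ^+ n.+1) = (fun x => f x * f x ^+ n).
  by apply/funext => x; rewrite exprS.
exact: contM.
Qed.

Lemma contnorm (R : realType) (T : topologicalType) (f : T -> R) :
  continuous f -> continuous (fun x => `|f x|).
Proof. by move=> cf x; apply: cvg_norm; exact: cf. Qed.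

Lemma contsqrt (R : realType) (T : topologicalType) (f : T -> R) :
  continuous f -> continuous (fun x => Num.sqrt (f x)).
Proof.
move=> cf x; apply: (@continuous_comp _ _ _ f (@Num.sqrt R)); first exact: cf.
exact: sqrt_continuous.
Qed.

Lemma contmax (R : realType) (T : topologicalType) (f g : T -> R) :
  continuous f -> continuous g -> continuous (fun x => Num.max (f x) (g x)).
Proof. by move=> cf cg; exact: (max_fun_continuous cf cg). Qed.

Lemma contpair (T U V : topologicalType) (f : T -> U) (g : T -> V) :
  continuous f -> continuous g -> continuous (fun x => (f x, g x)).
Proof. by move=> cf cg x; apply: cvg_pair; [exact: cf | exact: cg]. Qed.

Lemma contcst (T U : topologicalType) (a : U) : continuous (fun _ : T => a).
Proof. by move=> x; exact: cvg_cst. Qed.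

Lemma contfst (T U V : topologicalType) (f : T -> U * V) :
  continuous f -> continuous (fun x => (f x).1).
Proof. by move=> cf x; apply: (@continuous_comp _ _ _ f fst); [exact: cf | exact: cvg_fst]. Qed.

Lemma contsnd (T U V : topologicalType) (f : T -> U * V) :
  continuous f -> continuous (fun x => (f x).2).
Proof. by move=> cf x; apply: (@continuous_comp _ _ _ f snd); [exact: cf | exact: cvg_snd]. Qed.

Lemma contcomp (T U V : topologicalType) (f : T -> U) (g : U -> V) :
  continuous f -> continuous g -> continuous (fun x => g (f x)).
Proof. by move=> cf cg x; apply: (@continuous_comp _ _ _ f g); [exact: cf | exact: cg]. Qed.

Lemma contid (T : topologicalType) : continuous (fun x : T => x).
Proof. by move=> x; exact: cvg_id. Qed.

(** Recursion on the syntax of the function; continuity of the named functions in it is taken from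
    the context. *)
Ltac cont :=
  lazymatch goal with
  | |- continuous ?F =>
    lazymatch F with
    | (fun x => x) => exact (@contid _)
    | (fun _ => ?c) => exact (@contcst _ _ c)
    | (fun x => (@?f x, @?g x)) => refine (@contpair _ _ _ f g _ _); cont
    | (fun x => (@?f x) + (@?g x)) => refine (@contD _ _ f g _ _); cont
    | (fun x => (@?f x) * (@?g x)) => refine (@contM _ _ f g _ _); cont
    | (fun x => - (@?f x)) => refine (@contN _ _ f _); cont
    | (fun x => (@?f x) ^+ ?n) => refine (@contX _ _ f n _); cont
    | (fun x => Num.max (@?f x) (@?g x)) => refine (@contmax _ _ f g _ _); cont
    | (fun x => `|@?f x|) => refine (@contnorm _ _ f _); cont
    | (fun x => Num.sqrt (@?f x)) => refine (@contsqrt _ _ f _); cont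
    | (fun x => (@?f x).1) => refine (@contfst _ _ _ f _); cont
    | (fun x => (@?f x).2) => refine (@contsnd _ _ _ f _); cont
    | (fun x => ?g (@?f x)) =>
        first [assumption | refine (@contcomp _ _ _ f g _ _); [cont | try assumption]]
    | _ => try assumption
    end
  end.

(** A parametrisation without trigonometry: the abscissa runs linearly from 1 to -1 and back, and
    the ordinate is a square root, taken with sign + on the way out and - on the way back. *)
Lemma circle_param (R : realType) : exists c1 c2 : R -> R,
  [/\ continuous c1, continuous c2, (c1 0 = 1 /\ c1 1 = 1) /\ (c2 0 = 0 /\ c2 1 = 0),
      forall t, 0 <= t <= 1 -> c1 t ^+ 2 + c2 t ^+ 2 = 1 &
      (forall x y, x ^+ 2 + y ^+ 2 = 1 -> exists2 t, 0 <= t < 1 & c1 t = x /\ c2 t = y) /\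
      (forall t t', 0 <= t < 1 -> 0 <= t' < 1 -> c1 t = c1 t' -> c2 t = c2 t' -> t = t')].
Proof.
pose c1 (t : R) := `|4 * t - 2| - 1.
(* On each half of [[0, 1]] the radicand belonging to the other half is nonpositive, and [Num.sqrt]
   is 0 there. *)
pose c2 (t : R) := Num.sqrt (1 - (1 - 4 * t) ^+ 2) - Num.sqrt (1 - (4 * t - 3) ^+ 2).
have c1l t : t <= 1 / 2 -> c1 t = 1 - 4 * t.
  by move=> h; rewrite /c1 ler0_norm; lra.
have c1r t : 1 / 2 <= t -> c1 t = 4 * t - 3.
  by move=> h; rewrite /c1 ger0_norm; lra.
have c2l t : t <= 1 / 2 -> c2 t = Num.sqrt (1 - (1 - 4 * t) ^+ 2).
  by move=> h; rewrite /c2 [X in _ - X]ler0_sqrtr ?subr0 //; nra.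
have c2r t : 1 / 2 <= t -> c2 t = - Num.sqrt (1 - (4 * t - 3) ^+ 2).
  by move=> h; rewrite /c2 ler0_sqrtr ?sub0r //; nra.
exists c1, c2; split.
- by rewrite /c1; cont.
- by rewrite /c2; cont.
- split; split.
  + by rewrite c1l; lra.
  + by rewrite c1r; lra.
  + by rewrite c2l ?mulr0 ?subr0 ?expr1n ?subrr ?sqrtr0 //; lra.
  + by rewrite c2r ?ler0_sqrtr ?oppr0 //; lra.
- move=> t /andP[t0 t1]; have [h|h] := leP t (1 / 2).
    rewrite c1l // c2l // sqr_sqrtr; first by ring.
    have : 0 <= t * (1 / 2 - t) by rewrite mulr_ge0 // subr_ge0.
    by nra.
  rewrite c1r ?(ltW h) // c2r ?(ltW h) // sqrrN sqr_sqrtr; first by ring.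
  have : 0 <= (1 - t) * (t - 1 / 2) by rewrite mulr_ge0 // subr_ge0 // ltW.
  by nra.
- split.
  + move=> x y xy; have x1 : -1 <= x <= 1 by apply/andP; split; nra.
    have [y0|y0] := leP 0 y.
      exists ((1 - x) / 4); first lra.
      split; first by rewrite c1l; lra.
      rewrite c2l; last lra.
      have -> : 1 - (1 - 4 * ((1 - x) / 4)) ^+ 2 = y ^+ 2.
        have -> : y ^+ 2 = 1 - x ^+ 2 by lra.
        by field.
      by rewrite sqrtr_sqr ger0_norm.
    have x1' : x != 1 by apply/eqP => xe; move: xy; rewrite xe; nra.
    exists ((3 + x) / 4).
      have : x < 1 by rewrite lt_neqAle x1'; case/andP: x1.
      by lra.
    split; first by rewrite c1r; lra.
    rewrite c2r; last lra.
    have -> : 1 - (4 * ((3 + x) / 4) - 3) ^+ 2 = y ^+ 2.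
        have -> : y ^+ 2 = 1 - x ^+ 2 by lra.
        by field.
    by rewrite sqrtr_sqr ltr0_norm // opprK.
  + have aux t t' : 0 <= t < 1 -> 0 <= t' < 1 -> t <= 1 / 2 -> 1 / 2 < t' ->
        c1 t = c1 t' -> c2 t = c2 t' -> False.
      move=> ht ht' h h'; rewrite c1l // c1r ?(ltW h') // c2l // c2r ?(ltW h') //.
      move=> e1; have -> : 4 * t' - 3 = 1 - 4 * t by [].
      have := sqrtr_ge0 (1 - (1 - 4 * t) ^+ 2) => s0 s1.
      have : Num.sqrt (1 - (1 - 4 * t) ^+ 2) = 0 by lra.
      move/eqP; rewrite sqrtr_eq0 => hh.
      have : t = 0 \/ t = 1 / 2 by nra.
      by case; lra.
    move=> t t' ht ht' e1 e2.
    have [h|h] := leP t (1 / 2); have [h'|h'] := leP t' (1 / 2).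
    * by move: e1; rewrite !c1l //; lra.
    * by case: (aux t t').
    * by case: (aux t' t).
    * by move: e1; rewrite !c1r; lra.
Qed.

Lemma IVT_continuous (R : realType) (h : R -> R) (a b c : R) : continuous h ->
  a <= b -> h a <= c <= h b \/ h b <= c <= h a -> exists2 x, a <= x <= b & h x = c.
Proof.
move=> ch ab H.
have [| |x xab hx] := @IVT R h a b c ab.
- exact: continuous_subspaceT.
- rewrite ge_min le_max.
  by case: H => /andP[-> ->]; rewrite ?orbT.
by exists x => //; move: xab; rewrite in_itv.
Qed.

Lemma no_sign_change (R : realType) (h : R -> R) (a b : R) : continuous h ->
  (forall t, a < t < b -> h t <> 0) ->
  (forall t, a < t < b -> h t < 0) \/ (forall t, a < t < b -> 0 < h t).
Proof.
move=> ch nz; apply: contrapT => /not_orP[].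
move=> /existsNP[t /not_implyP[ht /negP]]; rewrite -leNgt => t0.
move=> /existsNP[t' /not_implyP[ht' /negP]]; rewrite -leNgt => t'0.
have [tt|tt] := leP t t'.
  have [|x xt hx] := IVT_continuous (c := 0) ch tt; first by right; rewrite t'0.
  by apply: (nz x) hx; lra.
have [|x xt hx] := IVT_continuous (c := 0) ch (ltW tt); first by left; rewrite t'0.
by apply: (nz x) hx; lra.
Qed.

(** Otherwise the preimages of [A] and [B] would separate the connected segment [[a, b]]. *)
Lemma clopen_path (R : realType) (T : topologicalType) (A B : set T) (h : R -> T) (a b : R) :
  continuous h -> closed A -> closed B -> (forall p, A p -> B p -> False) ->
  (forall t, a <= t <= b -> A (h t) \/ B (h t)) -> a <= b -> A (h a) ->
  forall t, a <= t <= b -> A (h t).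
Proof.
move=> ch cA cB dis AB ab Aa t tab; apply: contrapT => nA.
have Bt : B (h t) by case: (AB t tab).
have /connectedP := @segment_connected R a b.
pose C := `[a, b]%classic : set R.
move=> /(_ (fun i : bool => C `&` h @^-1` (if i then A else B))); apply.
have cC : closed C by exact: itv_closed.
have cA' : closed (h @^-1` A) by apply: preimage_closed => // x _; exact: ch.
have cB' : closed (h @^-1` B) by apply: preimage_closed => // x _; exact: ch.
split.
- case.
    by exists a; split; [rewrite /C /= in_itv /= lexx ab | exact: Aa].
  by exists t; split; [rewrite /C /= in_itv | exact: Bt].
- rewrite -setIUr; apply/seteqP; split=> x; last by case.
  move=> xC; split=> //; have : a <= x <= b by move: xC; rewrite /C /= in_itv.
  by move/AB => -[]; [right | left].
- split; apply/seteqP; split=> // x [].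
    rewrite -((closure_id (C `&` _)).1); last exact: closedI.
    by move=> [_ ?] [_ ?]; apply: (dis (h x)).
  move=> [_ ?]; rewrite -((closure_id (C `&` _)).1); last exact: closedI.
  by move=> [_ ?]; apply: (dis (h x)).
Qed.

(** * A criterion for not being an unlink *)

(** The circles have radius 1 and centres 3 apart, so passing from one to another forces an abscissa
    [3 * m + 3 / 2], which no circle attains. *)
Lemma unlink_path_one_circle (R : realType) (n : nat) (h : R -> R * R * R) (a b : R) :
  continuous h -> a <= b -> (forall x, a <= x <= b -> unlink_std R n (h x)) ->
  exists k : nat, forall x, a <= x <= b ->
    ((h x).1.1 - 3 * k%:R) ^+ 2 + (h x).1.2 ^+ 2 = 1 /\ (h x).2 = 0.
Proof.
move=> ch ab hU; have [|k _ ka] := hU a; first by rewrite lexx.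
exists k => x xab; have [k' _ kx] := hU x xab.
suff -> : k = k' by [].
have c1 : continuous (fun x => (h x).1.1) by cont.
have near_center (m : nat) (p : R * R * R) :
    (p.1.1 - 3 * m%:R) ^+ 2 + p.1.2 ^+ 2 = 1 /\ p.2 = 0 ->
    3 * m%:R - 1 <= p.1.1 <= 3 * m%:R + 1.
  by case=> e _; apply/andP; split; nra.
have gap (m m' : nat) (s t : R) : a <= s <= b -> a <= t <= b -> (m < m')%N ->
    3 * m%:R - 1 <= (h s).1.1 <= 3 * m%:R + 1 ->
    3 * m'%:R - 1 <= (h t).1.1 <= 3 * m'%:R + 1 -> False.
  move=> sab tab mm hs ht.
  have mm' : m%:R + 1 <= m'%:R :> R by rewrite natr1 ler_nat.
  have [y yab hy] : exists2 y, a <= y <= b & (h y).1.1 = 3 * m%:R + 3 / 2.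
    have [st|ts] := leP s t.
      have [|y yst hy] := IVT_continuous (c := 3 * m%:R + 3 / 2) c1 st; first by left; lra.
      by exists y => //; lra.
    have [|y yst hy] := IVT_continuous (c := 3 * m%:R + 3 / 2) c1 (ltW ts); first by right; lra.
    by exists y => //; lra.
  have [l _ /near_center] := hU y yab; rewrite hy.
  have [lm|ml] := leqP l m.
    have : l%:R <= m%:R :> R by rewrite ler_nat.
    by lra.
  have : m%:R + 1 <= l%:R :> R by rewrite natr1 ler_nat.
  by lra.
have aab : a <= a <= b by rewrite lexx.
case: (ltngtP k k') => // kk.
- by case: (gap _ _ _ _ aab xab kk (near_center _ _ ka) (near_center _ _ kx)).
- by case: (gap _ _ _ _ xab aab kk (near_center _ _ kx) (near_center _ _ ka)).
Qed.

(** The flat disc spanned by the [k]-th circle is out of reach of the other circles, whose centres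
    are at distance at least 3. It will be the spanning disc of a component. *)
Lemma unlink_disc_meets_circle (R : realType) (n k : nat) (x y : R) :
  x ^+ 2 + y ^+ 2 <= 1 -> unlink_std R n (3 * k%:R + x, y, 0) -> x ^+ 2 + y ^+ 2 = 1.
Proof.
move=> xy [l _ [/= e _]].
have x1 : -1 <= x <= 1 by apply/andP; split; nra.
have far (z : R) : 2 <= z \/ z <= - 2 -> z ^+ 2 + y ^+ 2 = 1 -> False by case; nra.
have [kl|lk|kl] := ltngtP k l.
- have : k%:R + 1 <= l%:R :> R by rewrite natr1 ler_nat.
  by move=> ?; case: (far _ _ e); right; lra.
- have : l%:R + 1 <= k%:R :> R by rewrite natr1 ler_nat.
  by move=> ?; case: (far _ _ e); left; lra.
- by rewrite -kl in e; rewrite -e; ring.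
Qed.

(* Reparametrises [0, 1] so that q becomes the midpoint. *)
Definition midpoint_at (R : realType) (q t : R) : R :=
  q * (1 - `|2 * t - 1|) + (t - 1 / 2 + `|t - 1 / 2|).

Lemma midpoint_at_path (R : realType) (q : R) : 0 < q < 1 ->
  let m := midpoint_at q in
  [/\ continuous m, [/\ m 0 = 0, m 1 = 1 & m (1 / 2) = q],
      forall t, 0 < t < 1 / 2 -> 0 < m t < q,
      forall t, 1 / 2 < t < 1 -> q < m t < 1 &
      forall t, 0 <= t <= 1 -> 0 <= m t <= 1].
Proof.
move=> qI m.
have ml t : t <= 1 / 2 -> m t = 2 * q * t.
  by move=> h; rewrite /m /midpoint_at !ler0_norm; lra.
have mr t : 1 / 2 <= t -> m t = q + (1 - q) * (2 * t - 1).
  by move=> h; rewrite /m /midpoint_at !ger0_norm; lra.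
split.
- by rewrite /m /midpoint_at; cont.
- by split; [rewrite ml | rewrite mr | rewrite ml]; lra.
- by move=> t tI; rewrite ml; [apply/andP; split; nra | lra].
- by move=> t tI; rewrite mr; [apply/andP; split; nra | lra].
- move=> t tI; have [th|th] := leP t (1 / 2).
    by rewrite ml //; apply/andP; split; nra.
  by rewrite mr ?(ltW th) //; apply/andP; split; nra.
Qed.

(* The map (u, v) sends the spanning disc of a component K of the unlink away from 0, although it
   sends K, which crosses the half-plane u <= 0 exactly once, to a loop of winding number +-1. *)
Lemma not_unlink_of_puncture (R : realType) (L A B : set (R * R * R))
    (u v : R * R * R -> R) (h : R -> R * R * R) (x0 x1 x2 : R) :
  L = A `|` B -> closed A -> closed B -> (forall p, A p -> B p -> False) ->
  continuous u -> continuous v -> continuous h ->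
  (forall p, u p = 0 -> v p = 0 -> L p) ->
  x0 < x1 -> x1 < x2 ->
  (forall x, x0 <= x <= x2 -> A (h x)) ->
  u (h x1) = 0 -> u (h x2) = 0 -> v (h x1) * v (h x2) < 0 ->
  (forall x, x1 < x < x2 -> u (h x) < 0) -> 0 < u (h x0) ->
  (forall p, A p -> u p <= 0 -> exists2 x, x1 <= x <= x2 & p = h x) ->
  ~ is_unlink R L.
Proof.
move=> LAB cA cB dAB cu cv ch uvL x01 x12 Ah u1 u2 v12 uneg upos Au [n [f [g [cf cg fK gK fL]]]].
have LU p : L p -> unlink_std R n (f p) by rewrite -fL => Lp; exists p.
have UL q : unlink_std R n q -> L (g q) by rewrite -fL => -[p Lp <-]; rewrite fK.
have Lh x : x0 <= x <= x2 -> L (h x) by move=> /Ah ?; rewrite LAB; left.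
have x02 := lt_trans x01 x12.
have [k hk] : exists k : nat, forall x, x0 <= x <= x2 ->
    ((f (h x)).1.1 - 3 * k%:R) ^+ 2 + (f (h x)).1.2 ^+ 2 = 1 /\ (f (h x)).2 = 0.
  apply: (@unlink_path_one_circle R n (fun x => f (h x)) x0 x2) => //; [|exact: ltW|].
    exact: (@contcomp _ _ _ h f).
  by move=> x /Lh/LU.
have h1 : x0 <= x1 <= x2 by rewrite !ltW.
have h2 : x0 <= x2 <= x2 by rewrite lexx ltW.
have [c1 [c2 [cc1 cc2 [[c10 c11] [c20 c21]] cir [onto inj]]]] := circle_param R.
have [P1 P2] := hk _ h1.
set p1 := _ - _ in P1; set p2 := (f (h x1)).1.2 in P1.
have fP : f (h x1) = (3 * k%:R + p1, p2, 0).
  by rewrite -P2 /p1 /p2 addrC subrK; case: (f _) => [[]].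
(* Complex multiplication by [p1 + i p2] rotates the circle so that parameter 0 corresponds to
   [h x1]. *)
pose e (t : R) := (p1 * c1 t - p2 * c2 t, p1 * c2 t + p2 * c1 t).
have eH x : x0 <= x <= x2 -> exists2 t, 0 <= t < 1 &
    f (h x) = (3 * k%:R + (e t).1, (e t).2, 0).
  move=> xI; have [q1 q2] := hk x xI.
  set a := (f (h x)).1.1 - 3 * k%:R in q1; set b := (f (h x)).1.2 in q1.
  (* The rotation is undone by multiplying [a + i b] with the conjugate of [p1 + i p2]. *)
  have [|t tI [t1 t2]] := onto (p1 * a + p2 * b) (p1 * b - p2 * a).
    by transitivity ((p1 ^+ 2 + p2 ^+ 2) * (a ^+ 2 + b ^+ 2)); [ring | rewrite P1 q1 mul1r].
  exists t => //; rewrite /e /= t1 t2.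
  have -> : p1 * (p1 * a + p2 * b) - p2 * (p1 * b - p2 * a) = (p1 ^+ 2 + p2 ^+ 2) * a by ring.
  have -> : p1 * (p1 * b - p2 * a) + p2 * (p1 * a + p2 * b) = (p1 ^+ 2 + p2 ^+ 2) * b by ring.
  by rewrite P1 !mul1r -q2 /a /b addrC subrK; case: (f _) => [[]].
(* The image under [g] of the flat disc in polar coordinates: [G 1] runs round the component [K],
   and [G 0] is constant. *)
pose G (r t : R) := g (3 * k%:R + r * (e t).1, r * (e t).2, 0).
have e_sq t : 0 <= t <= 1 -> (e t).1 ^+ 2 + (e t).2 ^+ 2 = 1.
  move=> /cir ct; transitivity ((p1 ^+ 2 + p2 ^+ 2) * (c1 t ^+ 2 + c2 t ^+ 2)); first by rewrite /e /=; ring.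
  by rewrite P1 ct mul1r.
have G_circle r t : 0 <= r <= 1 -> 0 <= t <= 1 -> L (G r t) -> r = 1.
  move=> rI tI /LU; rewrite gK => /unlink_disc_meets_circle.
  have -> : (r * (e t).1) ^+ 2 + (r * (e t).2) ^+ 2 = r ^+ 2 * ((e t).1 ^+ 2 + (e t).2 ^+ 2) by ring.
  by rewrite e_sq // mulr1 => rr; have := rr _; nra.
have e0 : e 0 = (p1, p2) by rewrite /e c10 c20 !mulr1 !mulr0 subr0 add0r.
have e1 : e 1 = (p1, p2) by rewrite /e c11 c21 !mulr1 !mulr0 subr0 add0r.
have Ge x t : f (h x) = (3 * k%:R + (e t).1, (e t).2, 0) -> G 1 t = h x.
  by rewrite /G !mul1r => <-; rewrite fK.
have G0 : G 1 0 = h x1 by apply: Ge; rewrite e0.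
have G1 : G 1 1 = h x1 by apply: Ge; rewrite e1.
(* The index [k] came without a bound; [k < n] is recovered from the circle through [f (h x1)]. *)
have GL t : 0 <= t <= 1 -> L (G 1 t).
  move=> tI; apply: UL; rewrite !mul1r.
  have [k' kn] : exists2 k' : nat, (k' < n)%N & k' = k.
    have [l ln hl] := LU _ (Lh _ h1); exists l => //.
    have := hl; rewrite fP /= => -[lp _].
    have pp : p1 - 1 <= 0 /\ 0 <= p1 + 1 by split; nra.
    have far (z : R) : 2 <= z \/ z <= - 2 -> z ^+ 2 + p2 ^+ 2 = 1 -> False by case; nra.
    have [kl|kl|//] := ltngtP k l.
      have : k%:R + 1 <= l%:R :> R by rewrite natr1 ler_nat.
      by move=> ?; case: (far _ _ lp); right; lra.
    have : l%:R + 1 <= k%:R :> R by rewrite natr1 ler_nat.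
    by move=> ?; case: (far _ _ lp); left; lra.
  move=> kk; exists k; first by rewrite -kk.
  by rewrite /= addrAC subrr add0r e_sq.
have cG r0 : continuous r0 -> forall t0 : R * R -> R, continuous t0 -> continuous (fun p => G (r0 p) (t0 p)).
  move=> cr t0 ct; rewrite /G /e /=.
  refine (@contcomp _ _ _ (fun p => (3 * k%:R + r0 p * (p1 * c1 (t0 p) - p2 * c2 (t0 p)),
    r0 p * (p1 * c2 (t0 p) + p2 * c1 (t0 p)), 0)) g _ cg).
  by cont.
have cG1 : continuous (fun t => G 1 t).
  rewrite /G /e /=.
  refine (@contcomp _ _ _ (fun t => (3 * k%:R + 1 * (p1 * c1 t - p2 * c2 t),
    1 * (p1 * c2 t + p2 * c1 t), 0)) g _ cg).
  by cont.
have GA t : 0 <= t <= 1 -> A (G 1 t).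
  apply: (clopen_path cG1 cA cB dAB) => //.
    by move=> s sI; have := GL s sI; rewrite LAB.
  by rewrite G0; exact: Ah.
(* The points [h x1] and [h x2] have parameters 0 and [q], distinct because [v] has opposite signs
   there; they cut [K] into two arcs. *)
have [q qI fq] := eH _ h2.
have Gq : G 1 q = h x2 by exact: Ge.
have q0 : 0 < q.
  rewrite lt_neqAle; case/andP: qI => -> _; rewrite andbT; apply/eqP => qq.
  by move: Gq v12; rewrite -qq G0 => ->; nra.
have q1 : q < 1 by case/andP: qI.
have {}qI : 0 < q < 1 by rewrite q0.
have injG s t : 0 <= s < 1 -> 0 <= t < 1 -> G 1 s = G 1 t -> s = t.
  move=> sI tI /(can_inj gK); rewrite !mul1r /e /= => -[/addrI E1 E2].
  apply: inj => //.
    transitivity ((p1 ^+ 2 + p2 ^+ 2) * c1 s); first by rewrite P1 mul1r.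
    transitivity (p1 * (p1 * c1 s - p2 * c2 s) + p2 * (p1 * c2 s + p2 * c1 s)); first by ring.
    rewrite E1 E2; transitivity ((p1 ^+ 2 + p2 ^+ 2) * c1 t); first by ring.
    by rewrite P1 mul1r.
  transitivity ((p1 ^+ 2 + p2 ^+ 2) * c2 s); first by rewrite P1 mul1r.
  transitivity (p1 * (p1 * c2 s + p2 * c1 s) - p2 * (p1 * c1 s - p2 * c2 s)); first by ring.
  rewrite E1 E2; transitivity ((p1 ^+ 2 + p2 ^+ 2) * c2 t); first by ring.
  by rewrite P1 mul1r.
have Unz t : 0 < t < 1 -> u (G 1 t) = 0 -> t = q.
  move=> tI ut; have tI' : 0 <= t <= 1 by lra.
  have [|x xI Gx] := Au _ (GA t tI'); first by rewrite ut.
  have [x1x|xx1] := eqVneq x x1.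
    have : t = 0 by apply: injG; rewrite ?G0 ?Gx ?x1x //; lra.
    by lra.
  have [x2x|xx2] := eqVneq x x2.
    by apply: injG; rewrite ?Gq ?Gx ?x2x //; lra.
  have := uneg x; rewrite !lt_neqAle eq_sym xx1 xx2; case/andP: xI => -> -> /(_ isT).
  by rewrite -Gx ut eqxx.
have cU : continuous (fun t => u (G 1 t)) by refine (@contcomp _ _ _ (fun t => G 1 t) u _ _).
have sgnL : (forall t, 0 < t < q -> u (G 1 t) < 0) \/ (forall t, 0 < t < q -> 0 < u (G 1 t)).
  apply: (no_sign_change cU) => t tI /Unz tq.
  by have := tq _; lra.
have sgnR : (forall t, q < t < 1 -> u (G 1 t) < 0) \/ (forall t, q < t < 1 -> 0 < u (G 1 t)).
  apply: (no_sign_change cU) => t tI /Unz tq.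
  by have := tq _; lra.
have arcs t : 0 <= t < 1 -> [\/ t = 0, t = q, 0 < t < q | q < t < 1].
  move=> tI; case: (ltrgtP t q) => tq; last by constructor 2.
    case: (eqVneq t 0) => t0; first by constructor 1.
    by constructor 3; rewrite andbT lt_neqAle eq_sym t0; case/andP: tI.
  by constructor 4; case/andP: tI.
(* The points at [mid] and [x0] show that [u] takes both signs on [K], so the two arcs carry
   opposite signs. *)
pose mid := (x1 + x2) / 2.
have midI : x1 < mid < x2 by rewrite /mid; lra.
have [tn tnI /Ge Gn] : exists2 t, 0 <= t < 1 & f (h mid) = (3 * k%:R + (e t).1, (e t).2, 0).
  by apply: eH; lra.
have [tp tpI /Ge Gp] : exists2 t, 0 <= t < 1 & f (h x0) = (3 * k%:R + (e t).1, (e t).2, 0).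
  by apply: eH; rewrite lexx ltW.
have un : u (G 1 tn) < 0 by rewrite Gn; exact: uneg.
have up : 0 < u (G 1 tp) by rewrite Gp.
pose m := midpoint_at q.
have [cm [m0 m1 mh] mL mR mI] := midpoint_at_path qI.
rewrite -/m in cm m0 m1 mh mL mR mI.
pose U (p : R * R) := u (G p.1 (m p.2)).
pose V (p : R * R) := v (G p.1 (m p.2)).
have cGm : continuous (fun p : R * R => G p.1 (m p.2)).
  refine (cG (fun p => p.1) _ (fun p => m p.2) _); first by cont.
  by refine (@contcomp _ _ _ (fun p : R * R => p.2) m _ cm); cont.
have contU : continuous U by refine (@contcomp _ _ _ (fun p : R * R => G p.1 (m p.2)) u _ _).
have contV : continuous V by refine (@contcomp _ _ _ (fun p : R * R => G p.1 (m p.2)) v _ _).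
(* A common zero lies on the link, hence at radius 1, on [K]; there [u] vanishes only at [h x1] and
   [h x2], where [v] does not. *)
have UVnz x y : 0 <= x <= 1 -> 0 <= y <= 1 -> ~ (U (x, y) = 0 /\ V (x, y) = 0).
  move=> xI yI [U0 V0]; have xe := G_circle _ _ xI (mI _ yI) (uvL _ U0 V0).
  move: U0 V0; rewrite /U /V /= xe => U0 V0.
  have [|z zI Gz] := Au _ (GA _ (mI _ yI)); first by rewrite U0.
  move: U0 V0; rewrite Gz => U0 V0.
  have [zx1|zx1] := eqVneq z x1; first by move: v12; rewrite -zx1 V0 mul0r ltxx.
  have [zx2|zx2] := eqVneq z x2; first by move: v12; rewrite -zx2 V0 mulr0 ltxx.
  have := uneg z; rewrite !lt_neqAle eq_sym zx1 zx2; case/andP: zI => -> -> /(_ isT).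
  by rewrite U0 eqxx.
have base y : U (0, y) = U (0, 0) /\ V (0, y) = V (0, 0).
  by rewrite /U /V /G /= !mul0r.
have per x : U (x, 0) = U (x, 1) /\ V (x, 0) = V (x, 1).
  have Gper : G x 0 = G x 1 by rewrite /G e0 e1.
  by rewrite /U /V /= m0 m1 Gper.
have U10 : U (1, 0) = 0 by rewrite /U /= m0 G0.
have U1h : U (1, 1 / 2) = 0 by rewrite /U /= mh Gq.
have V1 : V (1, 0) * V (1, 1 / 2) < 0 by rewrite /V /= m0 mh G0 Gq.
(* Equal signs contradict [tp] or [tn]; when [u] is positive on the first arc, [U] is replaced by
   its opposite. *)
case: sgnL sgnR => sL [] sR.
- case: (arcs tp tpI) => tpE; move: up.
  + by rewrite tpE G0 u1 ltxx.
  + by rewrite tpE Gq u2 ltxx.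
  + by rewrite ltNge ltW ?sL.
  + by rewrite ltNge ltW ?sR.
- apply: (no_null_loop contU contV UVnz base per U10 U1h V1) => t tI.
  + exact/sL/mL.
  + exact/sR/mR.
- apply: (@no_null_loop _ (fun p => - U p) V _ contV) => //.
  + by cont.
  + by move=> x y xI yI [/eqP]; rewrite oppr_eq0 => /eqP ? ?; apply: (UVnz x y).
  + by move=> y; have [-> ->] := base y.
  + by move=> x; have [-> ->] := per x.
  + by rewrite U10 oppr0.
  + by rewrite U1h oppr0.
  + by move=> t tI; rewrite oppr_lt0; exact/sL/mL.
  + by move=> t tI; rewrite oppr_gt0; exact/sR/mR.
- case: (arcs tn tnI) => tnE; move: un.
  + by rewrite tnE G0 u1 ltxx.
  + by rewrite tnE Gq u2 ltxx.
  + by rewrite ltNge ltW ?sL.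
  + by rewrite ltNge ltW ?sR.
Qed.

(** * Matched pairs and parallel copies *)

Lemma htS w t : ht w t.+1 = ht w t + (if nth false w t then 1 else -1).
Proof. by rewrite /ht big_ord_recr. Qed.

Lemma ht_count w t : ht w t = ((\sum_(u < t) nth false w u).*2)%:Z - t%:Z.
Proof.
elim: t => [|t IH]; first by rewrite /ht !big_ord0.
by rewrite htS IH big_ord_recr /=; case: (nth false w t) => /=; lia.
Qed.

Lemma mpairP w a b : mpair w a b ->
  [/\ (0 < a)%N, (a < b)%N, (b <= size w)%N, ht w b = ht w a.-1 &
      forall t, (a <= t)%N -> (t < b)%N -> ht w a.-1 < ht w t].
Proof.
case/and5P=> a0 ab bw _ /andP[/eqP hab /forallP low]; split=> // t at_ tb.
by have := low (Ordinal tb); rewrite /= at_.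
Qed.

Lemma mpair_adjacent w a : (0 < a)%N -> (a < size w)%N ->
  nth false w a.-1 -> ~~ nth false w a -> mpair w a a.+1.
Proof.
case: a => // a _ aw w1 w2; rewrite /mpair /= ltnSn aw w1 /=.
apply/andP; split; first by rewrite !htS w1 (negPf w2) addrK.
apply/forallP => t; apply/implyP => at_.
have -> : (t : nat) = a.+1 by have := ltn_ord t; lia.
by rewrite htS w1; lia.
Qed.

(** A height has the parity of its position, and the heights at [a - 1] and [b] agree. *)
Lemma mpair_odd w a b : mpair w a b -> odd b = ~~ odd a.
Proof. by case/mpairP => a0 ab _ + _; rewrite !ht_count; lia. Qed.

Definition laminar (a b a' b' : nat) : Prop :=
  [\/ a = a' /\ b = b', (b < a')%N, (b' < a)%N | (a < a')%N /\ (b' < b)%N] \/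
  (a' < a)%N /\ (b < b')%N.

Lemma laminar_pred a b a' b' : (0 < a)%N -> (0 < a')%N -> (a < b)%N -> (a' < b')%N ->
  laminar a b a' b' -> laminar a.-1 b.-1 a'.-1 b'.-1.
Proof.
move=> a0 a0' ab ab' [[[-> ->]|c|c|[c c']]|[c c']]; last by right; lia.
- by left; constructor 1.
- by left; constructor 2; lia.
- by left; constructor 3; lia.
- by left; constructor 4; lia.
Qed.

Lemma laminar_adjacent_ends a0 a b : (a < b)%N -> laminar a b a0 a0.+1 ->
  (a == a0) = (b == a0.+1) /\ (a == a0.+1) = (b == a0).
Proof.
move=> ab [[[-> ->]|c|c|[c c']]|[c c']]; first by rewrite !eqxx; split=> //; apply/eqP/eqP; lia.
all: by split; apply/eqP/eqP => e; lia.
Qed.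

Lemma laminar_adjacent_outside a0 a b : (a < b)%N -> a != a0 -> laminar a b a0 a0.+1 ->
  [\/ (b < a0)%N, (a0.+1 < a)%N | (a < a0)%N /\ (a0.+1 < b)%N].
Proof.
move=> ab /eqP aa [[[]|c|c|cc]|[]] //; last by lia.
- by constructor 1.
- by constructor 2.
- by constructor 3.
Qed.

(** If [a < a' <= b], the pair opening at [a'] starts from a strictly higher level than the one
    opening at [a], so it must close before the height returns to the lower level at [b]. *)
Lemma mpair_laminar w a b a' b' : mpair w a b -> mpair w a' b' -> laminar a b a' b'.
Proof.
move=> /mpairP[a0 ab _ e lo] /mpairP[a0' ab' _ e' lo'].
have aux x y x' y' : (0 < x)%N -> (x < x')%N -> ht w y = ht w x.-1 -> ht w y' = ht w x'.-1 ->
    (forall t, (x <= t)%N -> (t < y)%N -> ht w x.-1 < ht w t) ->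
    (forall t, (x' <= t)%N -> (t < y')%N -> ht w x'.-1 < ht w t) ->
    (x' <= y)%N -> (x' < y')%N -> (y' < y)%N.
  move=> x0 xx ey ey' l l' xy xy'.
  have h1 : ht w x.-1 < ht w x'.-1 by apply: l; lia.
  rewrite ltnNge; apply/negP => yy.
  have [yy'|yy'] := eqVneq y y'; first by move: h1; rewrite -ey -ey' yy' ltxx.
  by have := l' y xy; rewrite ltn_neqAle yy' yy ey => /(_ isT); lia.
have [aa|aa|aa] := ltngtP a a'.
- have [ba|ba] := ltnP b a'; first by left; constructor 2.
  by left; constructor 4; split=> //; apply: (aux a b a' b').
- have [ba|ba] := ltnP b' a; first by left; constructor 3.
  by right; split=> //; apply: (aux a' b' a b).
- left; constructor 1; split=> //; subst a'.
  have [bb|bb|//] := ltngtP b b'.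
    by have := lo' b (ltnW ab) bb; rewrite e; lia.
  by have := lo b' (ltnW ab') bb; rewrite e'; lia.
Qed.

(* Horizontal and vertical displacement of the j-th parallel copy from the central one. *)
Definition off (R : realType) (r j : nat) : R := (j%:R - cc R r) * dd R r.

Lemma dd_gt0 (R : realType) r : (0 < r)%N -> 0 < dd R r :> R.
Proof. by move=> r0; rewrite invr_gt0 ltr0n double_gt0. Qed.

Lemma dd_mul (R : realType) r : (0 < r)%N -> r%:R * dd R r = 1 / 2 :> R.
Proof.
move=> r0; have : r%:R != 0 :> R by rewrite pnatr_eq0 -lt0n.
by rewrite /dd -mul2n natrM => r1; field.
Qed.

(** Since [r * dd = 1 / 2], a bundle is less than 1/2 wide; this keeps bundles at different integer
    points apart. *)
Lemma off_ltr (R : realType) r j : (j < r)%N -> - (1 / 4) < off R r j < 1 / 4.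
Proof.
move=> jr; have r0 : (0 < r)%N by lia.
have d0 := dd_gt0 R r0; have dm := dd_mul R r0.
have j0 : 0 <= j%:R :> R by [].
have j1 : j%:R + 1 <= r%:R :> R by rewrite natr1 ler_nat.
by rewrite /off /cc; apply/andP; split; nra.
Qed.

Lemma off_mono (R : realType) r i j : (0 < r)%N -> (i < j)%N -> off R r i + dd R r <= off R r j.
Proof.
move=> r0 ij; have d0 := dd_gt0 R r0.
have ij' : i%:R + 1 <= j%:R :> R by rewrite natr1 ler_nat.
by rewrite /off; nra.
Qed.

Lemma off_lt (R : realType) r i j : (0 < r)%N -> (i < j)%N -> off R r i < off R r j.
Proof. by move=> r0 /(off_mono R r0); have := dd_gt0 R r0; lra. Qed.

Lemma off_inj (R : realType) r i j : (0 < r)%N -> off R r i = off R r j -> i = j.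
Proof.
by move=> r0 e; case: (ltngtP i j) => // /(off_lt R r0); rewrite e ltxx.
Qed.

(** The copies are symmetric about the central one; this puts the right leg of the [m]-th copy of an
    upper arc at [b - off R r m]. *)
Lemma off_rev (R : realType) r m : (m < r)%N -> off R r (r.-1 - m)%N = - off R r m.
Proof.
move=> mr; rewrite /off /cc natrB; last by lia.
have -> : r%:R = r.-1%:R + 1 :> R by rewrite natr1 prednK //; lia.
by field.
Qed.

Lemma xcE (R : realType) r k j : xc R r k j = k%:R + off R r j.
Proof. by []. Qed.

Lemma ycE (R : realType) r i : yc R r i = off R r i.
Proof. by []. Qed.

Lemma xc_inj (R : realType) r k j k' j' : (j < r)%N -> (j' < r)%N ->
  k%:R + off R r j = k'%:R + off R r j' -> k = k' /\ j = j'.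
Proof.
move=> jr jr'; have := off_ltr R jr; have := off_ltr R jr'.
case: (ltngtP k k') => [kk|kk|->].
- have : k%:R + 1 <= k'%:R :> R by rewrite natr1 ler_nat.
  by move=> *; exfalso; lra.
- have : k'%:R + 1 <= k%:R :> R by rewrite natr1 ler_nat.
  by move=> *; exfalso; lra.
- by move=> _ _ /addrI/off_inj h; split=> //; apply: h; lia.
Qed.

(** * Heights of the strands at and away from the crossings *)

Lemma eta_gt0 (R : realType) r : (0 < r)%N -> 0 < Defs.eta R r.
Proof. by move=> /(dd_gt0 R); rewrite /Defs.eta; lra. Qed.

Lemma eta_le (R : realType) r : (0 < r)%N -> Defs.eta R r <= 1 / 4.
Proof.
move=> r0; have := dd_mul R r0; have : 1 <= r%:R :> R by rewrite ler1n.
by have := dd_gt0 R r0; rewrite /Defs.eta; nra.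
Qed.

Lemma tent0 (R : realType) r : (0 < r)%N -> tent R r 0 = Defs.eta R r.
Proof. by move=> /(eta_gt0 R) e0; rewrite /tent normr0 subr0 max_r // ltW. Qed.

Lemma tent_far (R : realType) r (t : R) : Defs.eta R r <= `|t| -> tent R r t = 0.
Proof. by move=> h; rewrite /tent max_l // subr_le0. Qed.

Lemma off_far (R : realType) r i j : (0 < r)%N -> i != j -> Defs.eta R r <= `|off R r i - off R r j|.
Proof.
move=> r0; have d0 := dd_gt0 R r0.
rewrite neq_ltn /Defs.eta ler_normr => /orP[] /(off_mono R r0) h; apply/orP.
  by right; lra.
by left; lra.
Qed.

(** Neighbouring copies are [dd] apart and a tent has radius [dd / 4], so only the tent of this very
    crossing contributes. *)
Lemma zV_at (R : realType) r O k j i : (i < r)%N ->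
  zV R r O k j (off R r i) = if O k i j then - Defs.eta R r else 0.
Proof.
move=> ir; have r0 : (0 < r)%N by lia.
rewrite /zV (bigD1 (Ordinal ir)) //= big1 ?addr0 => [|i' ii].
  by rewrite ycE subrr tent0 //; case: ifP; rewrite ?oppr0.
rewrite ycE tent_far ?if_same // off_far //.
by apply: contra ii => /eqP ii; apply/eqP/val_inj.
Qed.

Lemma zV_out (R : realType) r O k j (y : R) : 1 / 2 <= `|y| -> zV R r O k j y = 0.
Proof.
move=> hy; rewrite /zV big1 ?oppr0 // => i _; have r0 : (0 < r)%N by have := ltn_ord i; lia.
rewrite tent_far ?if_same //; have := off_ltr R (ltn_ord i); have := eta_le R r0.
move=> e1 /andP[h1 h2]; apply: le_trans e1 _; rewrite ycE.
move: hy; rewrite !ler_normr => /orP[] ?; apply/orP; [left|right]; lra.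
Qed.

Lemma zH_at (R : realType) s r O k i j : (0 < k < s.*2)%N -> (j < r)%N ->
  zH R s r O i (k%:R + off R r j) = if O k i j then 0 else - Defs.eta R r.
Proof.
move=> ks jr; have r0 : (0 < r)%N by lia.
have oj := off_ltr R jr.
rewrite /zH (bigD1_seq k) ?mem_index_iota ?iota_uniq //= [X in _ + X]big1 ?addr0 => [|k' kk].
  rewrite (bigD1 (Ordinal jr)) //= big1 ?addr0 => [|j' jj].
    by rewrite xcE subrr tent0 //; case: ifP; rewrite ?oppr0.
  rewrite xcE opprD addrACA subrr add0r tent_far ?if_same // off_far //.
  by apply: contra jj => /eqP jj; apply/eqP/val_inj.
rewrite big1 // => j' _; rewrite tent_far ?if_same // xcE.
have oj' := off_ltr R (ltn_ord j'); apply: le_trans (eta_le R r0) _.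
rewrite ler_normr; move: kk; rewrite neq_ltn => /orP[] kk; apply/orP.
  have : k'%:R + 1 <= k%:R :> R by rewrite natr1 ler_nat.
  by move=> ?; left; lra.
have : k%:R + 1 <= k'%:R :> R by rewrite natr1 ler_nat.
by move=> ?; right; lra.
Qed.

Lemma continuous_sum (R : realType) (T : topologicalType) (I : Type) (l : seq I) (P : pred I) (F : I -> T -> R) :
  (forall i, continuous (F i)) -> continuous (fun x => \sum_(i <- l | P i) F i x).
Proof.
move=> cF; elim: l => [|i l IH].
  by under [X in continuous X]funext do rewrite big_nil; exact: contcst.
under [X in continuous X]funext do rewrite big_cons.
by case: (P i) => //; refine (@contD _ _ (F i) _ _ _).
Qed.

Lemma tent_continuous (R : realType) r (c : R) : continuous (fun x => tent R r (x - c)).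
Proof. by rewrite /tent; cont. Qed.

Lemma zH_continuous (R : realType) s r O i : continuous (zH R s r O i).
Proof.
rewrite /zH; refine (@contN _ _ _ _); apply: continuous_sum => k; apply: continuous_sum => j.
by case: (O k i j); [exact: contcst | exact: tent_continuous].
Qed.

Lemma zV_continuous (R : realType) r O k j : continuous (zV R r O k j).
Proof.
rewrite /zV; refine (@contN _ _ _ _); apply: continuous_sum => i.
by case: (O k i j); [exact: tent_continuous | exact: contcst].
Qed.

(** * Disjointness of the pieces of the link *)

(** Equations of a rectangular arc. The legs may end at different heights [ya] and [yb], as one of
    them reaches further when the arc turns into an axis copy. *)
Definition staple (R : realType) (x1 x2 ya yb h : R) (p : R * R * R) : Prop :=
  p.2 = 0 /\
  [\/ p.1.1 = x1 /\ ya <= p.1.2 <= h, p.1.2 = h /\ x1 <= p.1.1 <= x2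
    | p.1.1 = x2 /\ yb <= p.1.2 <= h].

Lemma seg_up (R : realType) (x y y' : R) p : y <= y' ->
  seg R (x, y, 0) (x, y', 0) p <-> p.2 = 0 /\ p.1.1 = x /\ y <= p.1.2 <= y'.
Proof.
move=> yy; split.
  by move=> [t /andP[t0 t1] ->] /=; split; [ring|split; [ring|apply/andP; split; nra]].
case: p => -[a b] c /= [-> [-> /andP[b0 b1]]].
have [e|ne] := eqVneq y y'.
  exists 0; first by rewrite lexx ler01.
  by rewrite /= !mul0r !addr0; congr (_, _, _); lra.
have d0 : 0 < y' - y by rewrite subr_gt0 lt_neqAle ne.
exists ((b - y) / (y' - y)).
  by rewrite divr_ge0 ?subr_ge0 //= ler_pdivrMr // mul1r; lra.
by rewrite /= divfK ?gt_eqF // !subrr !mulr0 !addr0; congr (_, _, _); ring.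
Qed.

Lemma seg_right (R : realType) (x x' y : R) p : x <= x' ->
  seg R (x, y, 0) (x', y, 0) p <-> p.2 = 0 /\ p.1.2 = y /\ x <= p.1.1 <= x'.
Proof.
move=> xx; split.
  by move=> [t /andP[t0 t1] ->] /=; split; [ring|split; [ring|apply/andP; split; nra]].
case: p => -[a b] c /= [-> [-> /andP[b0 b1]]].
have [e|ne] := eqVneq x x'.
  exists 0; first by rewrite lexx ler01.
  by rewrite /= !mul0r !addr0; congr (_, _, _); lra.
have d0 : 0 < x' - x by rewrite subr_gt0 lt_neqAle ne.
exists ((a - x) / (x' - x)).
  by rewrite divr_ge0 ?subr_ge0 //= ler_pdivrMr // mul1r; lra.
by rewrite /= divfK ?gt_eqF // !subrr !mulr0 !addr0; congr (_, _, _); ring.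
Qed.

Lemma seg_sym (R : realType) (p q : R * R * R) : seg R p q = seg R q p.
Proof.
have sub (a b : R * R * R) : seg R a b `<=` seg R b a.
  move=> x [t t01 ->]; exists (1 - t); first lra.
  by congr (_, _, _); ring.
by apply/seteqP; split.
Qed.

Lemma poly3_staple (R : realType) (x1 x2 ya yb h : R) p : x1 <= x2 -> ya <= h -> yb <= h ->
  poly3 R (x1, ya, 0) (x1, h, 0) (x2, h, 0) (x2, yb, 0) p <-> staple x1 x2 ya yb h p.
Proof.
move=> hx ha hb; rewrite /poly3 /staple [seg R (x2, h, 0) _]seg_sym; split.
  by move=> [[/seg_up|/seg_right]|/seg_up] => -[] // ? [? ?]; split=> //;
    [constructor 1|constructor 2|constructor 3].
move=> [z0 [[? ?]|[? ?]|[? ?]]]; [left; left|left; right|right].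
- by apply/seg_up.
- by apply/seg_right.
- by apply/seg_up.
Qed.

(** This reflection turns lower arcs into staples, so that one analysis serves both half-planes. *)
Definition flip_y (R : realType) (p : R * R * R) : R * R * R := (p.1.1, - p.1.2, p.2).

Lemma poly3_flip_y (R : realType) (a b c d p : R * R * R) :
  poly3 R a b c d p <-> poly3 R (flip_y a) (flip_y b) (flip_y c) (flip_y d) (flip_y p).
Proof.
have sub (q q' x : R * R * R) : seg R q q' x -> seg R (flip_y q) (flip_y q') (flip_y x).
  by move=> [t t01 ->]; exists t => //; rewrite /flip_y /=; congr (_, _, _); ring.
have fK : involutive (@flip_y R) by case=> -[x y] z; rewrite /flip_y /= opprK.
have bus q q' x : seg R (flip_y q) (flip_y q') (flip_y x) -> seg R q q' x.
  by move=> /sub; rewrite !fK.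
rewrite /poly3; split=> -[[h|h]|h].
- by left; left; apply: sub.
- by left; right; apply: sub.
- by right; apply: sub.
- by left; left; apply: bus.
- by left; right; apply: bus.
- by right; apply: bus.
Qed.

Lemma uarc_staple (R : realType) s r a b m p : (a < b)%N -> (m < r)%N ->
  uarc R s r a b m p <->
  staple (a%:R + off R r m) (b%:R - off R r m) (1 / 2)
    (if b == s.*2 then off R r m else 1 / 2) (b%:R - a%:R - off R r m) p.
Proof.
move=> ab mr; have om := off_ltr R mr.
have ab' : a%:R + 1 <= b%:R :> R by rewrite natr1 ler_nat.
rewrite /uarc !xcE off_rev // ycE.
have -> : (b - a)%N%:R + (cc R r - m%:R) * dd R r = b%:R - a%:R - off R r m.
  by rewrite natrB ?(ltnW ab) // /off; ring.
by apply: poly3_staple; [lra|lra|case: ifP => _; lra].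
Qed.

Lemma larc_staple (R : realType) r a b m p : (0 < a)%N -> (a < b)%N -> (m < r)%N ->
  larc R r a b m p <->
  staple (a.-1%:R + off R r m) (b.-1%:R - off R r m)
    (if a == 1%N then off R r m else 1 / 2) (1 / 2) (b.-1%:R - a.-1%:R - off R r m) (flip_y p).
Proof.
move=> a0 ab mr; have om := off_ltr R mr.
have ab' : a.-1%:R + 1 <= b.-1%:R :> R by rewrite natr1 ler_nat; lia.
rewrite /larc !xcE off_rev // ycE off_rev //.
have -> : (b.-1 - a.-1)%N%:R + (cc R r - m%:R) * dd R r = b.-1%:R - a.-1%:R - off R r m.
  by rewrite natrB ?/off; [ring|lia].
have -> : (a.-1 == 0)%N = (a == 1)%N by lia.
rewrite poly3_flip_y /flip_y /= !opprK.
have -> : - (if a == 1%N then - off R r m else - (1 / 2)) = (if a == 1%N then off R r m else 1 / 2).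
  by case: ifP; rewrite opprK.
by apply: poly3_staple; [lra|case: ifP => _; lra|lra].
Qed.

Lemma staple_beside (R : realType) (x1 x2 ya yb h x1' x2' ya' yb' h' : R) p :
  x1 <= x2 -> x2 < x1' -> x1' <= x2' ->
  staple x1 x2 ya yb h p -> staple x1' x2' ya' yb' h' p -> False.
Proof. by move=> ? ? ? [_ [[? _]|[_ ?]|[? _]]] [_ [[? _]|[_ ?]|[? _]]]; lra. Qed.

Lemma staple_inside (R : realType) (x1 x2 ya yb h x1' x2' ya' yb' h' : R) p :
  x1 < x1' -> x1' <= x2' -> x2' < x2 -> h' < h -> ya' <= h' -> yb' <= h' ->
  staple x1 x2 ya yb h p -> staple x1' x2' ya' yb' h' p -> False.
Proof. by move=> ? ? ? ? ? ? [_ [[? _]|[? _]|[? _]]] [_ [[? ?]|[? ?]|[? ?]]]; lra. Qed.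

(** The top of a staple is as high as the staple is wide, up to an offset, so a nested arc is both
    narrower and lower; the same holds for a later parallel copy of one arc. *)
Lemma laminar_staples (R : realType) r a b m a' b' m' (ya yb ya' yb' : R) p :
  (m < r)%N -> (m' < r)%N -> (a < b)%N -> (a' < b')%N ->
  ya <= 1 / 2 -> yb <= 1 / 2 -> ya' <= 1 / 2 -> yb' <= 1 / 2 ->
  laminar a b a' b' ->
  staple (a%:R + off R r m) (b%:R - off R r m) ya yb (b%:R - a%:R - off R r m) p ->
  staple (a'%:R + off R r m') (b'%:R - off R r m') ya' yb' (b'%:R - a'%:R - off R r m') p ->
  a = a' /\ m = m'.
Proof.
move=> mr mr' ab ab' h1 h2 h3 h4.
have om := off_ltr R mr; have om' := off_ltr R mr'; have r0 : (0 < r)%N by lia.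
have ltR (x y : nat) : (x < y)%N -> x%:R + 1 <= y%:R :> R by rewrite natr1 ler_nat.
have abR := ltR _ _ ab; have abR' := ltR _ _ ab'.
case=> [[[ea eb]|/ltR c|/ltR c|[/ltR c /ltR c']]|[/ltR c /ltR c']] st st'.
- subst a' b'; split=> //; case: (ltngtP m m') => // /(off_lt R r0) mm; exfalso.
    by apply: (staple_inside _ _ _ _ _ _ st st'); lra.
  by apply: (staple_inside _ _ _ _ _ _ st' st); lra.
- by exfalso; apply: (staple_beside _ _ _ st st'); lra.
- by exfalso; apply: (staple_beside _ _ _ st' st); lra.
- by exfalso; apply: (staple_inside _ _ _ _ _ _ st st'); lra.
- by exfalso; apply: (staple_inside _ _ _ _ _ _ st' st); lra.
Qed.

(* Pieces of the link of a given colour: [hc] colours the axis copies and [col] the copies of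
   the strands through the points 1, ..., 2s-1 (an arc has the colour of its end strands). *)
Section Colouring.
Variables (R : realType) (s r : nat) (U W : seq bool) (O : nat -> nat -> nat -> bool).
Variables (hc : nat -> bool) (col : nat -> nat -> bool).

(** Read at the right end of a lower arc, because its left end may be the point 0, which carries no
    strand. *)
Definition lcol (b m : nat) := col b.-1 (r.-1 - m)%N.

Definition coloured (c : bool) : set (R * R * R) :=
  (\bigcup_(i in [set i : nat | (i < r)%N && (hc i == c)]) hstrand R s r O i)
  `|` (\bigcup_(kj in [set kj : nat * nat | [&& (0 < kj.1 < s.*2)%N, (kj.2 < r)%N & col kj.1 kj.2 == c]])
         vstrand R r O kj.1 kj.2)
  `|` (\bigcup_(abm in [set abm : nat * nat * nat |
                         [&& mpair U abm.1.1 abm.1.2, (abm.2 < r)%N & col abm.1.1 abm.2 == c]])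
         uarc R s r abm.1.1 abm.1.2 abm.2)
  `|` (\bigcup_(abm in [set abm : nat * nat * nat |
                         [&& mpair W abm.1.1 abm.1.2, (abm.2 < r)%N & lcol abm.1.2 abm.2 == c]])
         larc R r abm.1.1 abm.1.2 abm.2).

Lemma link_coloured : meander_link R s r U W O = coloured true `|` coloured false.
Proof.
apply/seteqP; split=> p.
  move=> [[[|]|]|].
  - move=> [i ir hp]; case e : (hc i); [left|right]; left; left; left; exists i => //=; rewrite e; apply/andP; split=> //; exact: ir.
  - move=> [kj /andP[k1 k2] hp]; case e : (col kj.1 kj.2); [left|right]; left; left; right; exists kj => //=; rewrite e k1 k2 //.
  - move=> [x /andP[k1 k2] hp]; case e : (col x.1.1 x.2); [left|right]; left; right; exists x => //=; rewrite e k1 k2 //.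
  - move=> [x /andP[k1 k2] hp]; case e : (lcol x.1.2 x.2); [left|right]; right; exists x => //=; rewrite e k1 k2 //.
have sub c : coloured c p -> meander_link R s r U W O p.
  move=> [[[|]|]|] [x].
  - by move=> /andP[x1 _] hp; left; left; left; exists x.
  - by move=> /and3P[x1 x2 _] hp; left; left; right; exists x; rewrite //= x1.
  - by move=> /and3P[x1 x2 _] hp; left; right; exists x; rewrite //= x1.
  - by move=> /and3P[x1 x2 _] hp; right; exists x; rewrite //= x1.
by case=> /sub.
Qed.

Hypotheses (r0 : (0 < r)%N) (sU : size U = s.*2) (sW : size W = s.*2).
(** Colours agree wherever an arc joins two strands or turns into an axis copy. Nothing is asked at
    crossings, where the strands are disjoint in space. *)
Hypothesis colU : forall a b m, mpair U a b -> (b < s.*2)%N -> (m < r)%N -> col a m = col b (r.-1 - m)%N.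
Hypothesis colU_axis : forall a m, mpair U a s.*2 -> (m < r)%N -> col a m = hc m.
Hypothesis colW : forall a b m, mpair W a b -> (1 < a)%N -> (m < r)%N -> col a.-1 m = lcol b m.
Hypothesis colW_axis : forall b m, mpair W 1 b -> (m < r)%N -> lcol b m = hc (r.-1 - m)%N.

Let ltR (x y : nat) : (x < y)%N -> x%:R + 1 <= y%:R :> R.
Proof. by rewrite natr1 ler_nat. Qed.

Lemma uarc_size a b : mpair U a b -> [/\ (0 < a)%N, (a < b)%N & (b <= s.*2)%N].
Proof. by move=> /mpairP[? ?]; rewrite sU. Qed.

Lemma larc_size a b : mpair W a b -> [/\ (0 < a)%N, (a < b)%N & (b <= s.*2)%N].
Proof. by move=> /mpairP[? ?]; rewrite sW. Qed.

(** * Which pieces of the link can meet *)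

Lemma meet_hh i i' p : hstrand R s r O i p -> hstrand R s r O i' p -> i = i'.
Proof. by move=> [x _ ->] [x' _ [_ + _]]; rewrite !ycE; apply: off_inj. Qed.

(** At a crossing exactly one of the two strands is lowered, by [eta]. *)
Lemma meet_hv i k j p : (i < r)%N -> (0 < k < s.*2)%N -> (j < r)%N ->
  hstrand R s r O i p -> vstrand R r O k j p -> False.
Proof.
move=> ir ks jr [x _ ->] [y _ [ex ey]]; rewrite ex -ey xcE ycE zH_at // zV_at //.
by have := eta_gt0 R r0; case: ifP; lra.
Qed.

Lemma meet_vv k j k' j' p : (j < r)%N -> (j' < r)%N ->
  vstrand R r O k j p -> vstrand R r O k' j' p -> k = k' /\ j = j'.
Proof. by move=> jr jr' [y _ ->] [y' _ [e _ _]]; apply: (xc_inj (R := R) jr jr'); rewrite -!xcE. Qed.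

(** Axis copies stay within 1/4 of the axis, where only the right leg of an arc ending at [2s]
    descends. Axis copy [i] stops at [2s - off i], and the leg stands at [2s - off m] with foot at
    height [off m]; the two inequalities give equality. *)
Lemma meet_hu i a b m p : (i < r)%N -> (m < r)%N -> mpair U a b ->
  hstrand R s r O i p -> uarc R s r a b m p -> b = s.*2 /\ i = m.
Proof.
move=> ir mr /uarc_size[a0 ab bs] [x + ->] /(uarc_staple _ _ ab mr)[_ /=].
have oi := off_ltr R ir; have om := off_ltr R mr; have := ltR ab.
have -> : (cc R r - i%:R) * dd R r = - off R r i by rewrite /off; ring.
rewrite ycE => h1 h2 [[_ h]|[h _]|[h h']]; try by exfalso; lra.
move: h h'; case: eqP => [->|_] h h'; last by exfalso; lra.
split=> //; apply: (off_inj (R := R) r0).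
by lra.
Qed.

Lemma meet_hl i a b m p : (i < r)%N -> (m < r)%N -> mpair W a b ->
  hstrand R s r O i p -> larc R r a b m p -> a = 1%N /\ i = (r.-1 - m)%N.
Proof.
move=> ir mr /larc_size[a0 ab bs] [x + ->] /(larc_staple _ a0 ab mr)[_ /=].
have oi := off_ltr R ir; have om := off_ltr R mr.
have h2 : a.-1%:R + 1 <= b.-1%:R :> R by apply: ltR; lia.
have -> : (cc R r - i%:R) * dd R r = - off R r i by rewrite /off; ring.
rewrite ycE => h1 [[h h']|[h _]|[_ h]]; try by exfalso; lra.
move: h'; case: eqP => [a1|_] h'; last by exfalso; lra.
split=> //; apply: (off_inj (R := R) r0); rewrite off_rev //.
by move: h; rewrite a1 /=; lra.
Qed.

Lemma meet_vu k j a b m p : (0 < k < s.*2)%N -> (j < r)%N -> (m < r)%N -> mpair U a b ->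
  vstrand R r O k j p -> uarc R s r a b m p ->
  k = a /\ j = m \/ (b < s.*2)%N /\ k = b /\ j = (r.-1 - m)%N.
Proof.
move=> /andP[k0 ks] jr mr /uarc_size[a0 ab bs] [y yI ->] /(uarc_staple _ _ ab mr)[_ /=].
have oj := off_ltr R jr; have om := off_ltr R mr; have abR := ltR ab.
rewrite xcE => -[[h _]|[h _]|[h _]].
- by left; apply: (xc_inj jr mr h).
- by exfalso; lra.
- right; move: h; rewrite -off_rev // => h.
  have mr' : (r.-1 - m < r)%N by lia.
  have [kb jm] := xc_inj jr mr' h.
  by rewrite -kb.
Qed.

Lemma meet_vl k j a b m p : (0 < k < s.*2)%N -> (j < r)%N -> (m < r)%N -> mpair W a b ->
  vstrand R r O k j p -> larc R r a b m p ->
  (1 < a)%N /\ k = a.-1 /\ j = m \/ k = b.-1 /\ j = (r.-1 - m)%N.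
Proof.
move=> /andP[k0 ks] jr mr /larc_size[a0 ab bs] [y yI ->] /(larc_staple _ a0 ab mr)[_ /=].
have oj := off_ltr R jr; have om := off_ltr R mr.
have h2 : a.-1%:R + 1 <= b.-1%:R :> R by apply: ltR; lia.
rewrite xcE => -[[h _]|[h _]|[h _]].
- by left; have [ka jm] := xc_inj jr mr h; split; first lia.
- by exfalso; lra.
- right; move: h; rewrite -off_rev // => h.
  have mr' : (r.-1 - m < r)%N by lia.
  exact: (xc_inj jr mr' h).
Qed.

Lemma meet_uu a b m a' b' m' p : (m < r)%N -> (m' < r)%N -> mpair U a b -> mpair U a' b' ->
  uarc R s r a b m p -> uarc R s r a' b' m' p -> a = a' /\ m = m'.
Proof.
move=> mr mr' ab ab'; have := mpair_laminar ab ab'.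
have [_ lab _] := uarc_size ab; have [_ lab' _] := uarc_size ab'.
have om := off_ltr R mr; have om' := off_ltr R mr'.
move=> lam /(uarc_staple _ _ lab mr) st /(uarc_staple _ _ lab' mr') st'.
by apply: (laminar_staples mr mr' lab lab' _ _ _ _ lam st st'); try case: ifP => _; lra.
Qed.

Lemma meet_ll a b m a' b' m' p : (m < r)%N -> (m' < r)%N -> mpair W a b -> mpair W a' b' ->
  larc R r a b m p -> larc R r a' b' m' p -> b = b' /\ m = m'.
Proof.
move=> mr mr' ab ab'; have lam := mpair_laminar ab ab'.
have [a0 lab _] := larc_size ab; have [a0' lab' _] := larc_size ab'.
have om := off_ltr R mr; have om' := off_ltr R mr'.
move=> /(larc_staple _ a0 lab mr) st /(larc_staple _ a0' lab' mr') st'.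
have l1 : (a.-1 < b.-1)%N by lia.
have l2 : (a'.-1 < b'.-1)%N by lia.
have lam' := laminar_pred a0 a0' lab lab' lam.
have end_le c k : (k < r)%N -> (if c then off R r k else 1 / 2) <= 1 / 2.
  by move=> /(off_ltr R); case: c; lra.
have [aa mm] := laminar_staples mr mr' l1 l2 (end_le _ _ mr) (lexx _) (end_le _ _ mr') (lexx _) lam' st st'.
split=> //.
have {}aa : a = a' by lia.
by subst a'; case: lam => [[[]|h|h|[h h']]|[h h']]; lia.
Qed.

(** An upper arc leaves the region [y >= 1 / 2] only along a right leg near [x = 2s], a lower arc
    leaves [y <= - (1 / 2)] only along a left leg near [x = 0]. *)
Lemma meet_ul a b m a' b' m' p : (0 < s)%N -> (m < r)%N -> (m' < r)%N -> mpair U a b -> mpair W a' b' ->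
  uarc R s r a b m p -> larc R r a' b' m' p -> False.
Proof.
move=> s0 mr mr' /uarc_size[a0 ab bs] /larc_size[a0' ab' bs'].
have om := off_ltr R mr; have om' := off_ltr R mr'; have h1 := ltR ab.
have h2 : a'.-1%:R + 1 <= b'.-1%:R :> R by apply: ltR; lia.
have s0' : 0 + 1 <= s.*2%:R :> R by rewrite add0r ler1n double_gt0.
move=> /(uarc_staple _ _ ab mr) [_ st] /(larc_staple _ a0' ab' mr') [_ /= st'].
have low' : (if a' == 1%N then off R r m' else 1 / 2) <= - p.1.2 -> p.1.2 <= 1 / 4.
  by case: ifP => _; lra.
have [bs2|bs2] := eqVneq b s.*2; last first.
  rewrite (negPf bs2) in st.
  have y1 : 1 / 2 <= p.1.2 by case: st => [[? ?]|[? ?]|[? ?]]; lra.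
  by case: st' => [[_ /andP[/low' ? _]]|[? ?]|[? ?]]; lra.
rewrite bs2 eqxx in st h1.
have [y1 y2] : - (1 / 4) <= p.1.2 /\ (p.1.2 <= 1 / 4 -> 1 / 2 <= p.1.1).
  by case: st => [[? ?]|[? ?]|[? ?]]; split; lra.
have a1 : a' = 1%N -> a'.-1%:R = 0 :> R by move=> ->.
case: st' low' => [[x1 /andP[yl _]] /(_ yl)/y2|[? ?]|[? ?]]; try by lra.
have [/a1 ?|/negPf an1] := eqVneq a' 1%N; first by lra.
by move: yl; rewrite an1; lra.
Qed.

(** Two pieces that meet are equal or joined end to end, and the colouring hypotheses make their
    colours agree. *)
Lemma coloured_disjoint p : (0 < s)%N -> coloured true p -> coloured false p -> False.
Proof.
move=> s0.
pose on c : Prop := [\/ exists i, [/\ (i < r)%N, hstrand R s r O i p & hc i = c],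
  exists k j, [/\ (0 < k < s.*2)%N, (j < r)%N, vstrand R r O k j p & col k j = c],
  exists a b m, [/\ mpair U a b, (m < r)%N, uarc R s r a b m p & col a m = c] |
  exists a b m, [/\ mpair W a b, (m < r)%N, larc R r a b m p & lcol b m = c]].
have onP c : coloured c p -> on c.
  move=> [[[|]|]|] [x].
  - by move=> /andP[x1 /eqP x2] hp; constructor 1; exists x.
  - by move=> /and3P[x1 x2 /eqP x3] hp; constructor 2; exists x.1, x.2.
  - by move=> /and3P[x1 x2 /eqP x3] hp; constructor 3; exists x.1.1, x.1.2, x.2.
  - by move=> /and3P[x1 x2 /eqP x3] hp; constructor 4; exists x.1.1, x.1.2, x.2.
have hu i a b m c c' : (i < r)%N -> hstrand R s r O i p -> hc i = c ->
    mpair U a b -> (m < r)%N -> uarc R s r a b m p -> col a m = c' -> c = c'.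
  move=> ir hp <- ab mr up <-; have [bs ->] := meet_hu ir mr ab hp up.
  by rewrite (colU_axis (m := m)) // -bs.
have hl i a b m c c' : (i < r)%N -> hstrand R s r O i p -> hc i = c ->
    mpair W a b -> (m < r)%N -> larc R r a b m p -> lcol b m = c' -> c = c'.
  move=> ir hp <- ab mr up <-; have [a1 ->] := meet_hl ir mr ab hp up.
  by rewrite colW_axis // -a1.
have vu k j a b m c c' : (0 < k < s.*2)%N -> (j < r)%N -> vstrand R r O k j p -> col k j = c ->
    mpair U a b -> (m < r)%N -> uarc R s r a b m p -> col a m = c' -> c = c'.
  move=> ks jr vp <- ab mr up <-; have [[-> ->] //|[bs [-> ->]]] := meet_vu ks jr mr ab vp up.
  by rewrite (colU ab).
have vl k j a b m c c' : (0 < k < s.*2)%N -> (j < r)%N -> vstrand R r O k j p -> col k j = c ->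
    mpair W a b -> (m < r)%N -> larc R r a b m p -> lcol b m = c' -> c = c'.
  move=> ks jr vp <- ab mr up <-; have [[a1 [-> ->]]|[-> ->] //] := meet_vl ks jr mr ab vp up.
  exact: colW.
suff same c c' : on c -> on c' -> c = c' by move=> /onP h1 /onP h2; have := same _ _ h1 h2.
case=> [[i [i1 i2 i3]]|[k [j [k1 k2 k3 k4]]]|[a [b [m [a1 a2 a3 a4]]]]|[a [b [m [a1 a2 a3 a4]]]]];
  case=> [[i' [i1' i2' i3']]|[k' [j' [k1' k2' k3' k4']]]|[a' [b' [m' [a1' a2' a3' a4']]]]|[a' [b' [m' [a1' a2' a3' a4']]]]].
- by rewrite -i3 -i3' (meet_hh i2 i2').
- by case: (meet_hv i1 k1' k2' i2 k3').
- exact: (hu i a' b' m').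
- exact: (hl i a' b' m').
- by case: (meet_hv i1' k1 k2 i2' k3).
- by have [kk jj] := meet_vv k2 k2' k3 k3'; rewrite -k4 -k4' kk jj.
- exact: (vu k j a' b' m').
- exact: (vl k j a' b' m').
- by apply/esym; exact: (hu i' a b m).
- by apply/esym; exact: (vu k' j' a b m).
- by have [aa mm] := meet_uu a2 a2' a1 a1' a3 a3'; rewrite -a4 -a4' aa mm.
- by case: (meet_ul s0 a2 a2' a1 a1' a3 a3').
- by apply/esym; exact: (hl i' a b m).
- by apply/esym; exact: (vl k' j' a b m).
- by case: (meet_ul s0 a2' a2 a1' a1 a3' a3).
- by have [aa mm] := meet_ll a2 a2' a1 a1' a3 a3'; rewrite -a4 -a4' aa mm.
Qed.

End Colouring.

(** * Clasps *)

Lemma closed_arc (R : realType) (g : R -> R * R * R) (a b : R) (C : set (R * R * R)) :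
  continuous g -> (forall p, C p <-> exists2 t, a <= t <= b & p = g t) -> closed C.
Proof.
move=> cg Cg.
have -> : C = g @` `[a, b]%classic.
  apply/seteqP; split=> p.
    by move=> /Cg[t tI ->]; exists t => //=; rewrite in_itv.
  by move=> [t tI <-]; apply/Cg; exists t => //; move: tI; rewrite /= in_itv.
apply: compact_closed; first exact: norm_hausdorff.
apply: continuous_compact; last exact: segment_compact.
exact: continuous_subspaceT.
Qed.

Lemma closed_seg (R : realType) (p q : R * R * R) : closed (seg R p q).
Proof.
apply: (@closed_arc _ (fun t => (p.1.1 + t * (q.1.1 - p.1.1), p.1.2 + t * (q.1.2 - p.1.2),
          p.2 + t * (q.2 - p.2))) 0 1) => //.
by cont.
Qed.

Lemma closed_poly3 (R : realType) (p q u v : R * R * R) : closed (poly3 R p q u v).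
Proof. by apply: closedU; [apply: closedU|]; exact: closed_seg. Qed.

Lemma closed_hstrand (R : realType) s r O i : closed (hstrand R s r O i).
Proof.
apply: (@closed_arc _ (fun x => (x, yc R r i, zH R s r O i x))
  ((cc R r - i%:R) * dd R r) ((s.*2)%:R + (cc R r - i%:R) * dd R r)) => //.
have zc := @zH_continuous R s r O i.
by cont.
Qed.

Lemma closed_vstrand (R : realType) r O k j : closed (vstrand R r O k j).
Proof.
apply: (@closed_arc _ (fun y => (xc R r k j, y, zV R r O k j y)) (- (1 / 2)) (1 / 2)) => //.
have zc := @zV_continuous R r O k j.
by cont.
Qed.

Lemma closed_coloured (R : realType) s r U W O hc col c :
  closed (@coloured R s r U W O hc col c).
Proof.
have fin3 w : finite_set [set abm : nat * nat * nat | mpair w abm.1.1 abm.1.2 && (abm.2 < r)%N].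
  apply: (@sub_finite_set _ _ ((`I_(size w).+1 `*` `I_(size w).+1) `*` `I_r)); last first.
    by repeat apply: finite_setX; exact: finite_II.
  by move=> [[a b] m] /= /andP[/mpairP[? ? ? _ _] mr]; split=> //; split=> /=; lia.
apply: closedU; [apply: closedU; [apply: closedU|]|]; apply: closed_bigcup.
- apply: sub_finite_set (finite_II r).
  by move=> i /andP[].
- by move=> i _; exact: closed_hstrand.
- apply: (@sub_finite_set _ _ (`I_(s.*2) `*` `I_r)); last by apply: finite_setX; exact: finite_II.
  by move=> [k j] /and3P[/andP[_ ?] ? _]; split.
- by move=> x _; exact: closed_vstrand.
- by apply: sub_finite_set (fin3 U) => x /and3P[x1 x2 _]; rewrite /= x1.
- by move=> x _; exact: closed_poly3.
- by apply: sub_finite_set (fin3 W) => x /and3P[x1 x2 _]; rewrite /= x1.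
- by move=> x _; exact: closed_poly3.
Qed.

(* Orienting each strand by the parity of the point it crosses, the first copy is the one
   numbered 0 at odd points and r-1 at even points. *)
Definition first_copy (a0 r k j : nat) : bool :=
  [&& k != a0, k != a0.+1 & (if odd k then j else r.-1 - j)%N == 0%N].

(** An arc joins points of opposite parity and reverses the order of the copies; the two effects
    cancel. *)
Lemma first_copy_ends a0 r a b m : (a == a0) = (b == a0.+1) -> (a == a0.+1) = (b == a0) ->
  odd b = ~~ odd a -> (m < r)%N -> first_copy a0 r a m = first_copy a0 r b (r.-1 - m).
Proof.
move=> h1 h2 ob mr; rewrite /first_copy h1 h2 ob andbCA; congr (_ && (_ && _)).
by case: (odd a) => //=; rewrite subKn //; lia.
Qed.

Section Clasp.
Variables (R : realType) (s r : nat) (U W : seq bool) (O : nat -> nat -> nat -> bool) (a0 m0 : nat).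
Hypotheses (sU : size U = s.*2) (sW : size W = s.*2) (m0r : (m0 < r)%N).
Hypotheses (pU : mpair U a0 a0.+1) (pW : mpair W a0.+1 a0.+2).
Hypothesis clasp : O a0 0%N m0 != O a0.+1 0%N (r.-1 - m0)%N.

Let r_gt0 : (0 < r)%N. Proof. by lia. Qed.
Let a0_gt0 : (0 < a0)%N. Proof. by case/mpairP: pU. Qed.
Let a0_lt : (a0.+2 <= s.*2)%N. Proof. by case/mpairP: pW; rewrite sW. Qed.
Let a0_inner : (0 < a0 < s.*2)%N. Proof. by rewrite a0_gt0 (leq_trans _ a0_lt). Qed.
Let a0S_inner : (0 < a0.+1 < s.*2)%N. Proof. by rewrite a0_lt. Qed.
Let a0S_neq : (a0.+1 == s.*2) = false. Proof. by rewrite ltn_eqF. Qed.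
Let a0S_neq1 : (a0.+1 == 1)%N = false. Proof. by rewrite eqSS gtn_eqF. Qed.
Let m1r : (r.-1 - m0 < r)%N. Proof. by rewrite (leq_ltn_trans (leq_subr _ _)) // prednK. Qed.

Let x1 : R := a0%:R + off R r m0.
Let x2 : R := a0.+1%:R - off R r m0.
Let h : R := 1 - off R r m0.
Let ax (x : R) : R * R * R := (x, off R r 0, zH R s r O 0 x).
Let m1 := (r.-1 - m0)%N.
(** The circle numbered [m0] projects to the boundary of the rectangle [u <= 0]; its right side is
    copy [m1] at [a0 + 1]. The function [v] is the height above a surface through the circle,
    interpolated linearly between the heights of its two sides. *)
Let u (p : R * R * R) : R := Num.max (Num.max (x1 - p.1.1) (p.1.1 - x2)) (`|p.1.2| - h).
Let v (p : R * R * R) : R :=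
  p.2 - (zV R r O a0 m0 p.1.2 * ((x2 - p.1.1) / (x2 - x1)) +
         zV R r O a0.+1 m1 p.1.2 * ((p.1.1 - x1) / (x2 - x1))).

Let oI : - (1 / 4) < off R r m0 < 1 / 4. Proof. exact: off_ltr. Qed.
Let o0I : - (1 / 4) < off R r 0 < 1 / 4. Proof. exact: off_ltr. Qed.
Let a0S : a0.+1%:R = a0%:R + 1 :> R. Proof. by rewrite natr1. Qed.
Let x12 : 1 / 2 < x2 - x1. Proof. by have := oI; rewrite /x1 /x2 a0S; lra. Qed.

Lemma clasp_le0 p : u p <= 0 <-> x1 <= p.1.1 <= x2 /\ `|p.1.2| <= h.
Proof.
rewrite /u !ge_max !subr_le0; split.
  by move=> /andP[/andP[-> ->] ->].
by move=> [/andP[-> ->] ->].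
Qed.

Lemma clasp_eq0 p : u p = 0 -> [/\ x1 <= p.1.1 <= x2, `|p.1.2| <= h &
  [\/ p.1.1 = x1, p.1.1 = x2 | `|p.1.2| = h]].
Proof.
move=> u0; have [h1 h2] : x1 <= p.1.1 <= x2 /\ `|p.1.2| <= h by apply/clasp_le0; rewrite u0.
split=> //; have : 0 <= u p by rewrite u0.
rewrite /u !le_max !subr_ge0 => /orP[/orP[]|] h3.
- by constructor 1; lra.
- by constructor 2; lra.
- by constructor 3; lra.
Qed.

Lemma clasp_circle p : u p = 0 -> v p = 0 -> meander_link R s r U W O p.
Proof.
move=> /clasp_eq0[xI yI bd] v0.
have d0 : x2 - x1 != 0 by rewrite gt_eqF //; have := x12; lra.
have up q : uarc R s r a0 a0.+1 m0 q -> meander_link R s r U W O q.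
  by move=> hq; left; right; exists (a0, a0.+1, m0) => //=; rewrite pU.
have dn q : larc R r a0.+1 a0.+2 m0 q -> meander_link R s r U W O q.
  by move=> hq; right; exists (a0.+1, a0.+2, m0) => //=; rewrite pW.
have vs k j : (0 < k < s.*2)%N -> (j < r)%N -> vstrand R r O k j p -> meander_link R s r U W O p.
  by move=> kI jr hp; left; left; right; exists (k, j) => //=; rewrite kI.
have upE : staple x1 x2 (1 / 2) (1 / 2) h p -> meander_link R s r U W O p.
  move=> st; apply/up/uarc_staple => //; move: st.
  by rewrite a0S_neq (_ : a0.+1%:R - a0%:R - off R r m0 = h) // /h a0S; ring.
have dnE : staple x1 x2 (1 / 2) (1 / 2) h (flip_y p) -> meander_link R s r U W O p.
  move=> st; apply/dn/larc_staple => //; move: st.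
  by rewrite a0S_neq1 /= (_ : a0.+1%:R - a0%:R - off R r m0 = h) // /h a0S; ring.
(* A lateral side is a strand where [|y| <= 1 / 2] and a leg of an arc beyond, where the dips
   vanish. *)
have side k j : (0 < k < s.*2)%N -> (j < r)%N -> p.1.1 = xc R r k j -> p.2 = zV R r O k j p.1.2 ->
    p.1.1 = x1 \/ p.1.1 = x2 -> meander_link R s r U W O p.
  move=> kI jr ex ez xe.
  have [y0|y0] := leP `|p.1.2| (1 / 2).
    apply: (vs k j kI jr); exists p.1.2; first by move: y0; rewrite ler_norml.
    by rewrite -ex -ez; case: (p) => -[].
  have z0 : p.2 = 0 by rewrite ez zV_out // ltW.
  have [yp|yn] := leP 0 p.1.2.
    rewrite ger0_norm // in y0 yI.
    by apply: upE; split=> //; case: xe => xe; [constructor 1|constructor 3]; rewrite yI ltW.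
  rewrite ltr0_norm // in y0 yI.
  by apply: dnE; split=> //; case: xe => xe; [constructor 1|constructor 3]; rewrite /= yI ltW.
have xc2 : x2 = xc R r a0.+1 m1 by rewrite xcE off_rev.
have v0' : p.2 = zV R r O a0 m0 p.1.2 * ((x2 - p.1.1) / (x2 - x1)) +
                 zV R r O a0.+1 m1 p.1.2 * ((p.1.1 - x1) / (x2 - x1)).
  by apply/eqP; rewrite -subr_eq0 -/(v p) v0.
case: bd => e.
- apply: (side a0 m0) => //; last by left.
  by rewrite v0' e subrr mul0r mulr0 addr0 divff // mulr1.
- apply: (side a0.+1 m1) => //; [by rewrite e|  | by right].
  by rewrite v0' e subrr mul0r mulr0 add0r divff // mulr1.
have y2 : 1 / 2 <= `|p.1.2| by rewrite e /h; have := oI; lra.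
have z0 : p.2 = 0 by rewrite v0' !zV_out // !mul0r addr0.
have [yp|yn] := leP 0 p.1.2.
  by rewrite ger0_norm // in e; apply: upE; split=> //; constructor 2.
by rewrite ltr0_norm // in e; apply: dnE; split=> //; constructor 2.
Qed.

(** An arc to one side stays off [[x1, x2]]. An enclosing one has its legs outside and joins points
    at least 3 apart, so its top is above [h]. *)
Lemma clasp_avoids (P Q m : nat) (ya yb : R) p : (m < r)%N -> (P < Q)%N ->
  - (1 / 4) < ya -> - (1 / 4) < yb ->
  [\/ (Q < a0)%N, (a0.+1 < P)%N | (P < a0)%N /\ (a0.+1 < Q)%N] ->
  staple (P%:R + off R r m) (Q%:R - off R r m) ya yb (Q%:R - P%:R - off R r m) p ->
  x1 <= p.1.1 <= x2 -> `|p.1.2| <= h -> False.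
Proof.
have ltR (x y : nat) : (x < y)%N -> x%:R + 1 <= y%:R :> R by rewrite natr1 ler_nat.
move=> mr /ltR PQ _ _ pos [_ st]; rewrite ler_norml /x1 /x2 /h a0S => xI yI.
have om := off_ltr R mr; have o0 := oI.
case: pos => [/ltR c|/ltR c|[/ltR c /ltR c']]; rewrite ?a0S in c *; try rewrite a0S in c'.
all: by case: st => [[? _]|[? ?]|[? _]]; lra.
Qed.

Lemma clasp_axis_x0 : 0 < u (ax (a0%:R - 1 / 2)).
Proof. by rewrite /u !lt_max; apply/orP; left; apply/orP; left; rewrite /ax /= /x1; have := oI; lra. Qed.

Lemma clasp_axis_neg x : x1 < x < x2 -> u (ax x) < 0.
Proof.
move=> xI; rewrite /u !gt_max /ax /=.
have -> : `|off R r 0| - h < 0.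
  by rewrite subr_lt0 ltr_norml /h; have := oI; have := o0I; lra.
by rewrite andbT; apply/andP; split; lra.
Qed.

Lemma clasp_axis_end x : x = x1 \/ x = x2 -> u (ax x) = 0.
Proof.
have hh : `|off R r 0| - h < 0.
  by rewrite subr_lt0 ltr_norml /h; have := oI; have := o0I; lra.
have := x12 => x12'.
rewrite /u /ax /=; case=> ->; rewrite subrr.
  by rewrite [Num.max 0 _]max_l ?max_l; lra.
by rewrite [Num.max _ 0]max_r ?max_l; lra.
Qed.

(** At each crossing [v] is [eta] or [- eta] according to whether the axis copy is over or under,
    and the clasp makes the two differ. *)
Lemma clasp_axis_height : v (ax x1) * v (ax x2) < 0.
Proof.
have d0 : x2 - x1 != 0 by rewrite gt_eqF //; have := x12; lra.
have e0 := eta_gt0 R r_gt0.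
have -> : v (ax x1) = if O a0 0%N m0 then Defs.eta R r else - Defs.eta R r.
  rewrite /v /ax /= subrr mul0r mulr0 addr0 divff // mulr1 zV_at // zH_at //.
  by case: ifP => _; ring.
have -> : v (ax x2) = if O a0.+1 0%N m1 then Defs.eta R r else - Defs.eta R r.
  rewrite /v /ax /= subrr mul0r mulr0 add0r divff // mulr1 zV_at //.
  rewrite (_ : x2 = a0.+1%:R + off R r m1); last by rewrite off_rev.
  by rewrite zH_at //; case: ifP => _; ring.
by move: clasp; rewrite -/m1; case: (O a0 _ _); case: (O a0.+1 _ _) => // _; nra.
Qed.

Lemma clasp_col_uarc a b m : mpair U a b -> (m < r)%N ->
  first_copy a0 r a m = first_copy a0 r b (r.-1 - m).
Proof.
move=> ab mr; have [_ lab _ _ _] := mpairP ab.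
have [e1 e2] := laminar_adjacent_ends lab (mpair_laminar ab pU).
exact: first_copy_ends (mpair_odd ab) mr.
Qed.

Lemma clasp_col_larc a b m : mpair W a b -> (m < r)%N ->
  first_copy a0 r a.-1 m = first_copy a0 r b.-1 (r.-1 - m).
Proof.
move=> ab mr; have [la lab _ _ _] := mpairP ab.
have lab' : (a.-1 < b.-1)%N by rewrite -ltnS !prednK // (ltn_trans la).
have lam := laminar_pred la (ltn0Sn _) lab (ltnSn _) (mpair_laminar ab pW).
have [e1 e2] := laminar_adjacent_ends lab' lam.
apply: first_copy_ends => //.
case: a b ab la lab {lab' lam e1 e2} => // a [//|b] /mpair_odd /= /(congr1 negb).
by rewrite !negbK.
Qed.

Lemma clasp_only_axis p :
  @coloured R s r U W O (fun i => i == 0%N) (first_copy a0 r) true p -> u p <= 0 ->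
  exists2 x, x1 <= x <= x2 & p = ax x.
Proof.
move=> hp /clasp_le0[xI yI]; move: hp => [[[|]|]|] [].
- by move=> i /andP[_ /eqP/eqP ->] [x _ pe]; exists x => //; move: xI; rewrite pe.
- move=> [k j] /= /and3P[_ jr /eqP/and3P[k0 k1 _]] [y _ pe].
  exfalso; move: xI; rewrite pe /= xcE /x1 /x2 a0S.
  have := oI; have := off_ltr R jr => oj o0.
  case: (ltngtP k a0) k0 => // kk _.
    have : k%:R + 1 <= a0%:R :> R by rewrite natr1 ler_nat.
    by lra.
  have : a0.+1%:R + 1 <= k%:R :> R by rewrite natr1 ler_nat ltn_neqAle eq_sym k1.
  by rewrite a0S; lra.
- move=> [[a b] m] /= /and3P[ab mr /eqP/and3P[k0 _ _]].
  have [_ lab _ _ _] := mpairP ab; have lam := laminar_adjacent_outside lab k0 (mpair_laminar ab pU).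
  have om := off_ltr R mr.
  move=> /(uarc_staple _ _ lab mr) st; exfalso; apply: (clasp_avoids mr lab _ _ _ st xI yI).
  + by lra.
  + by case: ifP => _; lra.
  + exact: lam.
- move=> [[a b] m] /= /and3P[ab mr /eqP]; rewrite /lcol -(clasp_col_larc ab mr) => /and3P[k0 _ _].
  have [la lab _ _ _] := mpairP ab.
  have lab' : (a.-1 < b.-1)%N by rewrite -ltnS !prednK // (ltn_trans la).
  have lam := laminar_pred la (ltn0Sn _) lab (ltnSn _) (mpair_laminar ab pW).
  have {}lam := laminar_adjacent_outside lab' k0 lam.
  have om := off_ltr R mr.
  move=> /(larc_staple _ la lab mr) st; exfalso.
  have yI' : `|(flip_y p).1.2| <= h by rewrite /flip_y /= normrN.
  apply: (clasp_avoids mr lab' _ _ _ st xI yI').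
  + by case: ifP => _; lra.
  + by lra.
  + exact: lam.
Qed.

Theorem clasp_not_unlink : ~ is_unlink R (meander_link R s r U W O).
Proof.
have s0 : (0 < s)%N by move: a0_lt; case: (s).
(* Axis copy 0 together with the first copies of the strands at points other than [a0], [a0 + 1],
   and of their arcs: it meets the region [u <= 0] only along that axis copy. *)
pose A := @coloured R s r U W O (fun i => i == 0%N) (first_copy a0 r) true.
pose B := @coloured R s r U W O (fun i => i == 0%N) (first_copy a0 r) false.
have zV1 := @zV_continuous R r O a0 m0.
have zV2 := @zV_continuous R r O a0.+1 m1.
have zHc := @zH_continuous R s r O 0%N.
(* The abscissa [a0 - 1 / 2] lies to the left of the circle, since [x1 > a0 - 1 / 4]. *)
apply: (@not_unlink_of_puncture R _ A B u v ax (a0%:R - 1 / 2) x1 x2).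
- exact: link_coloured.
- exact: closed_coloured.
- exact: closed_coloured.
- move=> p; apply: coloured_disjoint => //.
  + by move=> a b m ab _; exact: clasp_col_uarc.
  (* As [2s] is even, [a] is odd, and there the first copy is the one numbered 0, like the axis copy
     it turns into. *)
  + move=> a m ab mr; have ob := mpair_odd ab.
    have oa : odd a by move: ob; rewrite odd_double => /esym/negbFE.
    have [_ lab _ _ _] := mpairP ab.
    rewrite /first_copy oa.
    have [e1 e2] := laminar_adjacent_ends lab (mpair_laminar ab pU).
    by rewrite e1 e2 eq_sym a0S_neq (gtn_eqF (ltnW a0_lt)).
  + by move=> a b m ab _ mr; exact: clasp_col_larc.
  (* The colour is transported to the left end, the even point 0, where the first copy is numbered
     [r - 1] and turns into axis copy 0. *)
  + move=> b m ab mr; rewrite /lcol -(clasp_col_larc ab mr) /first_copy /=.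
    by rewrite (ltn_eqF a0_gt0).
- by rewrite /u /x1 /x2; cont.
- by rewrite /v; cont.
- by rewrite /ax; cont.
- exact: clasp_circle.
- by rewrite /x1; have := oI; lra.
- by have := x12; lra.
- move=> x xI; left; left; left; exists 0%N; first by rewrite /= r_gt0.
  exists x => //.
  have -> : (cc R r - 0%:R) * dd R r = - off R r 0 by rewrite /off; ring.
  have : 1 <= a0%:R :> R by rewrite ler1n.
  have : a0%:R + 1 + 1 <= s.*2%:R :> R by rewrite !natr1 ler_nat.
  by move: xI; rewrite /x2 a0S; have := oI; have := o0I; lra.
- by apply: clasp_axis_end; left.
- by apply: clasp_axis_end; right.
- exact: clasp_axis_height.
- exact: clasp_axis_neg.
- exact: clasp_axis_x0.
- exact: clasp_only_axis.
Qed.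

End Clasp.

(** * Crossing information and pairs of words without clasps *)

Lemma ofunE s r (g : nat -> nat -> nat -> bool) k i j :
  (0 < k < s.*2)%N -> (i < r)%N -> (j < r)%N ->
  ofun s r [ffun x : 'I_(s.*2).-1 * 'I_r * 'I_r => g x.1.1.+1 x.1.2 x.2] k i j = g k i j.
Proof.
move=> /andP[k0 ks] ir jr; have ks' : (k.-1 < (s.*2).-1)%N by lia.
rewrite /ofun; case: insubP => [k' _ ek|]; last by rewrite ks'.
case: insubP => [i' _ ei|]; last by rewrite ir.
case: insubP => [j' _ ej|]; last by rewrite jr.
by rewrite k0 ffunE /= ek ei ej prednK.
Qed.

Lemma ofun_ord s r (f : xinfo s r) (x : 'I_(s.*2).-1 * 'I_r * 'I_r) :
  ofun s r f x.1.1.+1 x.1.2 x.2 = f x.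
Proof. by case: x => [[k i] j]; rewrite /ofun /= !valK. Qed.

(* At the crossing (k, i, j) the point (k, j) is the (k r + j)-th one along the i-th axis copy. *)
Lemma alternating_exists s r (U W : seq bool) : size U = s.*2 -> size W = s.*2 ->
  exists f : xinfo s r, Defs.alternating s r U W (ofun s r f).
Proof.
move=> sU sW; exists [ffun x : 'I_(s.*2).-1 * 'I_r * 'I_r => odd (x.1.1.+1 * r + x.1.2 + x.2)].
set O := ofun s r _.
have E k i j : (0 < k < s.*2)%N -> (i < r)%N -> (j < r)%N -> O k i j = odd (k * r + i + j).
  exact: (@ofunE s r (fun k i j => odd (k * r + i + j))).
have r1 : (0 < r)%N -> odd r.-1 = ~~ odd r by case: (r) => //= r' _; rewrite negbK.
have rm m : (m < r)%N -> odd (r.-1 - m) = ~~ odd r (+) odd m.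
  by move=> mr; rewrite oddB ?r1 //; lia.
move=> e1 e2 [|[|[|[|[|[|]]]]]].
- move=> [k [i [j [kI ir jr -> ->]]]]; rewrite /over_end !E // ?(ltnW jr) //.
  by rewrite !oddD !oddM /=; case: (odd k); case: (odd r); case: (odd i); case: (odd j).
- move=> [k [i [k0 k1 ir -> ->]]]; rewrite /over_end !E //; try by lia.
- move=> [k [i [j [kI ir jr -> ->]]]]; rewrite /over_end !E // ?(ltnW ir) //.
  by rewrite !oddD !oddM /=; case: (odd k); case: (odd r); case: (odd i); case: (odd j).
- move=> [a [b [m [/[dup] ab /mpairP[a0 lab _ _ _] bs mr -> ->]]]].
  have ob := mpair_odd ab; rewrite /over_end !E; try by lia.
- move=> [a [m [/[dup] ab /mpairP[a0 lab _ _ _] mr -> ->]]].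
  have ob := mpair_odd ab; rewrite /over_end !E; try by lia.
- move=> [a [b [m [/[dup] ab /mpairP[a0 lab + _ _] a1 mr -> ->]]]]; rewrite sW => bs.
  have ob := mpair_odd ab; rewrite /over_end !E; try by lia.
- move=> [b [i [/[dup] ab /mpairP[a0 lab + _ _] ir -> ->]]]; rewrite sW => bs.
  have ob := mpair_odd ab; rewrite /over_end !E; try by lia.
Qed.

(** Only disjoint windows of three positions are inspected, so that they can be counted
    independently. The pair in [W] is shifted by one, as a lower pair [a < b] joins the points
    [a - 1] and [b - 1]. *)
Definition clasped (s : nat) (U W : seq bool) : bool :=
  [exists q : 'I_(s.*2 %/ 3), [&& nth false U (3 * q), ~~ nth false U (3 * q + 1),
     nth false W (3 * q + 1) & ~~ nth false W (3 * q + 2)]].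

Lemma claspedP s (U W : seq bool) : size U = s.*2 -> size W = s.*2 -> clasped s U W ->
  exists2 a, mpair U a a.+1 & mpair W a.+1 a.+2.
Proof.
move=> sU sW /existsP[q /and4P[u1 u2 w1 w2]]; have := ltn_ord q => qs.
exists (3 * q).+1; apply: mpair_adjacent => //; rewrite ?sU ?sW.
- by lia.
- by rewrite -addn1.
- by lia.
- by rewrite /= -addn1.
- by rewrite -addn2.
Qed.

(** The innermost circle, numbered [r - 1], meets axis copy 0 in the last crossing at [a] and the
    first at [a + 1], which are consecutive along that copy. *)
Lemma alternating_clasp s r (U W : seq bool) (f : xinfo s r) a : (0 < r)%N -> size W = s.*2 -> mpair W a.+1 a.+2 -> (0 < a)%N ->
  Defs.alternating s r U W (ofun s r f) ->
  ofun s r f a 0 r.-1 != ofun s r f a.+1 0 (r.-1 - r.-1).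
Proof.
move=> r0 sW /mpairP[_ _ + _ _] a0 alt; rewrite sW subnn => as_.
by apply: (alt (a, 0, r.-1, true)%N (a.+1, 0, 0, true)%N); right; left; exists a, 0%N.
Qed.

(** Adding an arbitrary vector of [r] bits at the crossings of axis copy 0 over [a] is injective on
    [P]: the untouched crossings over [a + 1] determine the original bits, hence also the vector. *)
Lemma random_clasp_card s r (W : seq bool) a (P : pred (xinfo s r)) : (0 < r)%N -> size W = s.*2 ->
  mpair W a.+1 a.+2 -> (0 < a)%N ->
  (forall f, P f -> forall m, (m < r)%N -> ofun s r f a 0 m = ofun s r f a.+1 0 (r.-1 - m)) ->
  (#|P| * 2 ^ r <= #|xinfo s r|)%N.
Proof.
move=> r0 sW /mpairP[_ _ + _ _] a0 hP; rewrite sW => as_.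
have ka : (a.-1 < (s.*2).-1)%N by lia.
have kb : (a < (s.*2).-1)%N by lia.
pose k1 := Ordinal ka; pose k2 := Ordinal kb; pose i0 := Ordinal r0.
have sym (f : xinfo s r) : P f -> forall m, f (k1, i0, m) = f (k2, i0, rev_ord m).
  move=> Pf m; rewrite -(ofun_ord f (k1, i0, m)) -(ofun_ord f (k2, i0, rev_ord m)) /=.
  by rewrite prednK // (hP f Pf _ (ltn_ord m)); congr (ofun _ _ _ _ _ _); lia.
pose F (x : xinfo s r * {ffun 'I_r -> bool}) : xinfo s r :=
  [ffun y => x.1 y (+) ((y.1 == (k1, i0)) && x.2 y.2)].
have -> : (2 ^ r)%N = #|{ffun 'I_r -> bool}| by rewrite card_ffun card_bool card_ord.
rewrite -cardX -(@card_in_image _ _ F); first exact: max_card.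
have k12 : (k2 == k1) = false by apply/eqP => /(congr1 val) /=; lia.
move=> [f b] [g c] /andP[Pf _] /andP[Pg _] /ffunP E.
have E2 m : f (k2, i0, m) = g (k2, i0, m).
  by have := E (k2, i0, m); rewrite !ffunE /= xpair_eqE k12 /= !addbF.
have E1 m : f (k1, i0, m) = g (k1, i0, m) by rewrite !sym.
have bc : b = c.
  apply/ffunP => m; have := E (k1, i0, m); rewrite !ffunE /= eqxx /= E1.
  exact: addbI.
congr (_, _) => //; apply/ffunP => -[y m]; have := E (y, m).
by rewrite !ffunE /= bc => /addIb.
Qed.

(** * Counting pairs of words without a clasp in any window *)

Lemma windows_of_3 n i : (i < n)%N ->
  (exists2 q, (q < n %/ 3)%N & [\/ i = 3 * q, i = 3 * q + 1 | i = 3 * q + 2]%N) \/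
  (i = 3 * (n %/ 3) \/ i = 3 * (n %/ 3) + 1)%N.
Proof.
move=> iN; have e := divn_eq i 3; have im : (i %% 3 < 3)%N by rewrite ltn_mod.
have en := divn_eq n 3; have nm : (n %% 3 < 3)%N by rewrite ltn_mod.
have [qK|Kq] := ltnP (i %/ 3) (n %/ 3); last by right; lia.
left; exists (i %/ 3)%N => //.
by case: (i %% 3)%N im e => [|[|[|//]]] _ e; [constructor 1|constructor 2|constructor 3]; lia.
Qed.

(** A window of the two words has 64 possible contents, one of them a clasp; the at most two
    leftover positions of each word account for the factor 16. *)
Lemma unclasped_card s :
  (#|[pred x : (s.*2).-tuple bool * (s.*2).-tuple bool | ~~ clasped s x.1 x.2]|
     <= 63 ^ (s.*2 %/ 3) * 16)%N.
Proof.
set K := (s.*2 %/ 3)%N; set n := s.*2.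
pose T := ((bool * bool * bool) * (bool * bool * bool))%type.
pose S : pred T := fun x => ~~ [&& x.1.1.1, ~~ x.1.1.2, x.2.1.2 & ~~ x.2.2].
have S63 : (#|S| <= 63)%N.
  have -> : 63%N = #|{: T}|.-1 by rewrite !card_prod !card_bool.
  have bad : ((true, false, false), (true, true, false)) \notin S by [].
  have : (#|S| < #|{: T}|)%N.
    apply: proper_card; apply/properP; split; first exact: subset_predT.
    by exists ((true, false, false), (true, true, false)).
  by case: #|{: T}|.
pose win (x : n.-tuple bool * n.-tuple bool) (q : nat) : T :=
  ((nth false x.1 (3 * q), nth false x.1 (3 * q + 1), nth false x.1 (3 * q + 2)),
   (nth false x.2 (3 * q), nth false x.2 (3 * q + 1), nth false x.2 (3 * q + 2)))%N.
(* Of the incomplete window [K] only the first two entries are kept; positions past the end read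
   [false]. *)
pose F x : {ffun 'I_K -> T} * (bool * bool * (bool * bool)) :=
  ([ffun q : 'I_K => win x q], ((win x K).1.1, (win x K).2.1)).
have injF : injective F.
  move=> x y [/ffunP E e1 e2 e3 e4].
  have W q : (q < K)%N -> win x q = win y q.
    by move=> qK; have := E (Ordinal qK); rewrite !ffunE.
  have D i : (i < n)%N -> nth false x.1 i = nth false y.1 i /\ nth false x.2 i = nth false y.2 i.
    move=> /windows_of_3[[q qK]|[]].
    - by have [w0 w1 w2 w3 w4 w5] := W q qK; case=> ->.
    - by move=> ->.
    - by move=> ->.
  case: x y D {E W e1 e2 e3 e4} => [x1 x2] [y1 y2] /= D; congr (_, _).
    by apply: val_inj; apply: (@eq_from_nth _ false); rewrite ?size_tuple // => i /D[].
  by apply: val_inj; apply: (@eq_from_nth _ false); rewrite ?size_tuple // => i /D[].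
rewrite -(fintype.card_image injF).
apply: (@leq_trans #|predX (ffun_on S) [pred y : bool * bool * (bool * bool) | true]|).
  apply: subset_leq_card; apply/fintype.subsetP => _ /fintype.imageP[x nc ->].
  rewrite !inE andbT; apply/ffun_onP => q; rewrite ffunE.
  by move: nc => /existsPn/(_ q).
rewrite cardX; apply: leq_mul; last first.
  by apply: leq_trans (max_card _) _; rewrite !card_prod !card_bool.
rewrite card_ffun_on card_ord.
by have [->|K0] := posnP K; [rewrite !expn0 | rewrite leq_exp2r].
Qed.

(** * Counting p-strings *)

Lemma ht_catl x y t : (t <= size x)%N -> ht (x ++ y) t = ht x t.
Proof.
elim: t => [|t IH] tx; first by rewrite /ht !big_ord0.
by rewrite !htS IH ?(ltnW tx) // nth_cat tx.
Qed.

Lemma ht_catr x y v : ht (x ++ y) (size x + v) = ht x (size x) + ht y v.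
Proof.
elim: v => [|v IH]; first by rewrite addn0 ht_catl // [ht y 0]big_ord0 addr0.
by rewrite addnS !htS IH nth_cat ltnNge leq_addr /= addKn addrA.
Qed.

Lemma ht_drop b k v : (k <= size b)%N -> ht b (k + v) = ht b k + ht (drop k b) v.
Proof.
move=> kb; have := ht_catr (take k b) (drop k b) v.
rewrite cat_take_drop size_takel // => ->; congr (_ + _).
by rewrite -{2}[b](cat_take_drop k) ht_catl // size_takel.
Qed.

Lemma ht_negb y v : (v <= size y)%N -> ht (map negb y) v = - ht y v.
Proof.
elim: v => [|v IH] vy; first by rewrite /ht !big_ord0 oppr0.
by rewrite !htS IH ?(ltnW vy) // (nth_map false) // opprD; case: (nth _ _ _).
Qed.

(** As in the cycle lemma: a balanced word started at a lowest point has the original heights,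
    cyclically shifted, minus the minimum. *)
Lemma ht_rot_min b k : (k <= size b)%N -> ht b (size b) = 0 ->
  (forall t, (t <= size b)%N -> ht b k <= ht b t) ->
  ht (rot k b) (size b) = 0 /\ forall t, (t <= size b)%N -> 0 <= ht (rot k b) t.
Proof.
move=> kb b0 low; rewrite /rot.
have sd : size (drop k b) = (size b - k)%N by rewrite size_drop.
have hd v : ht (drop k b) v = ht b (k + v) - ht b k by rewrite ht_drop // addrC addKr.
have ht_take v : (v <= k)%N -> ht (take k b) v = ht b v.
  by move=> vk; rewrite -{2}[b](cat_take_drop k) ht_catl // size_takel.
have tail v : (v <= k)%N -> ht (drop k b ++ take k b) (size b - k + v) = ht b v - ht b k.
  by move=> vk; rewrite -sd ht_catr sd hd subnKC // b0 sub0r ht_take // addrC.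
split; first by rewrite -(subnK kb) tail // subrr.
move=> t tb; have [tk|kt] := leqP t (size b - k).
  by rewrite ht_catl ?sd // hd subr_ge0; apply: low; lia.
have -> : t = (size b - k + (t - (size b - k)))%N by lia.
by rewrite tail ?subr_ge0; [apply: low|]; lia.
Qed.

Lemma int_IVT (g : nat -> int) n : g 0%N <= 0 -> 0 <= g n ->
  (forall t, g t.+1 <= g t + 1) -> exists2 t, (t <= n)%N & g t = 0.
Proof.
move=> g0 gn st; elim: n gn => [|n IH] gn; first by exists 0%N => //; lia.
have [gn0|gn0] := leP 0 (g n); first by have [t tn gt] := IH gn0; exists t => //; exact: leqW.
by exists n.+1 => //; have := st n; lia.
Qed.

Definition flip_from (t : nat) (w : seq bool) : seq bool := take t w ++ map negb (drop t w).

Lemma size_flip_from t w : size (flip_from t w) = size w.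
Proof. by rewrite size_cat size_map -size_cat cat_take_drop. Qed.

Lemma flip_fromK t w : (t <= size w)%N -> flip_from t (flip_from t w) = w.
Proof.
move=> tw; have st : size (take t w) = t by rewrite size_takel.
rewrite /flip_from take_size_cat // drop_size_cat // -map_comp map_id_in ?cat_take_drop //.
by move=> x _; rewrite /= negbK.
Qed.

(** Negating the suffix from [t] gives final height [2 ht(t) - ht(n)]. Since [ht(n)] is even and
    steps are by 1, some [t] has half the final height. *)
Lemma flip_from_balanced w : ~~ odd (size w) ->
  exists2 t, (t <= size w)%N & ht (flip_from t w) (size w) = 0.
Proof.
move=> ev; set n := size w in ev *.
have [c hc] : exists c : int, ht w n = c + c.
  by rewrite ht_count; exists ((\sum_(u < n) nth false w u)%:Z - n./2%:Z); lia.
have [t tn ht_t] : exists2 t, (t <= n)%N & ht w t = c.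
  have h0 : ht w 0 = 0 by rewrite /ht big_ord0.
  have [c0|c0] := leP 0 c.
    have [||t|t tn gt] := @int_IVT (fun t => ht w t - c) n.
    - by rewrite h0; lia.
    - by rewrite hc; lia.
    - by rewrite htS; case: (nth _ _ _); lia.
    - by exists t => //; lia.
  have [||t|t tn gt] := @int_IVT (fun t => c - ht w t) n.
  - by rewrite h0; lia.
  - by rewrite hc; lia.
  - by rewrite htS; case: (nth _ _ _); lia.
  - by exists t => //; lia.
exists t => //; have st : size (take t w) = t by rewrite size_takel.
have := ht_catr (take t w) (map negb (drop t w)) (n - t).
rewrite st subnKC // => ->; rewrite ht_negb; last by rewrite size_drop.
have -> : ht (take t w) t = ht w t by rewrite -{2}[w](cat_take_drop t) ht_catl // st.
have := @ht_drop w t (n - t) tn; rewrite subnKC // hc ht_t.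
by lia.
Qed.

(* Every word is obtained from a p-string by a rotation followed by the negation of a suffix. *)
Lemma pstring_card s :
  (4 ^ s <= #|[pred d : (s.*2).-tuple bool | pstring s d]| * ((s.*2).+1 * (s.*2).+1))%N.
Proof.
set n := s.*2.
pose F (x : n.-tuple bool * ('I_n.+1 * 'I_n.+1)) : n.-tuple bool :=
  insubd x.1 (flip_from x.2.2 (rot x.2.1 x.1)).
have -> : (4 ^ s)%N = #|{: n.-tuple bool}|.
  by rewrite card_tuple card_bool /n -mul2n expnM.
have -> : ((n.+1 * n.+1) = #|{: 'I_n.+1 * 'I_n.+1}|)%N by rewrite card_prod card_ord.
rewrite -[X in (_ * X)%N](eq_card (A := predT)) // -cardX.
apply: leq_trans (leq_image_card F _); apply: subset_leq_card.
apply/fintype.subsetP => w _; apply/fintype.imageP.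
have sw : size w = n by rewrite size_tuple.
have [|t tn b0] := @flip_from_balanced w; first by rewrite sw odd_double.
set b := flip_from t w in b0; have sb : size b = n by rewrite size_flip_from.
rewrite sw in b0 tn.
have [k _ kmin] := @arg_minP _ _ _ (ord0 : 'I_n.+1) xpredT (fun k : 'I_n.+1 => ht b k) isT.
have kn : (k <= size b)%N by rewrite sb -ltnS.
have [||r0 rpos] := @ht_rot_min b k kn; first by rewrite sb.
  by move=> u; rewrite sb -ltnS => un; apply: (kmin (Ordinal un)).
rewrite sb in r0 rpos.
have sd : size (rot k b) == n by rewrite size_rot sb.
(* Rotating by [n - k] undoes the rotation by [k], and flipping again from [t] undoes the flip. *)
have nk : (n - k < n.+1)%N by lia.
exists (Tuple sd, (Ordinal nk, Ordinal (tn : (t < n.+1)%N))).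
  rewrite !inE andbT /pstring sd r0 eqxx andbT.
  by apply/forallP => u; apply: rpos; rewrite -ltnS.
apply: val_inj; rewrite /F.
have rK : rot (n - k) (rot k b) = b by have := rotK k b; rewrite /rotr size_rot sb.
by rewrite val_insubd /= rK size_flip_from sb eqxx flip_fromK ?sw.
Qed.

(** * The probabilities *)

Lemma bernoulli_le (R : realType) (x : R) n : 0 <= x -> 1 + n%:R * x <= (1 + x) ^+ n.
Proof.
move=> x0; elim: n => [|n IH]; first by rewrite mul0r addr0.
rewrite exprS -natr1.
have : 0 <= n%:R * x * x by rewrite !mulr_ge0.
have : (1 + x) * (1 + n%:R * x) <= (1 + x) * (1 + x) ^+ n by rewrite ler_wpM2l // addr_ge0.
by nra.
Qed.

(** With [L] about [K / 6], Bernoulli's inequality for the exponent [L] gives [(64/63)^K >= t^6]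
    where [t = 1 + L / 63]. Four factors [t] absorb the quartic, and one more absorbs the constant
    and [1 / e]. *)
Lemma geometric_beats_quartic (R : realType) (e : R) : 0 < e -> exists N : nat, forall s K : nat,
  (N <= s)%N -> K = (s.*2 %/ 3)%N -> 16 * (s.*2.+1)%:R ^+ 4 * 63 ^+ K <= e * 64 ^+ K.
Proof.
(* Here [1134 = 18 * 63], so that [c * t = 1134 + 18 L] bounds [2s + 1 <= 18 L + 18]. *)
move=> e0; have [c ce] : exists c : R, c = 1134 by exists 1134.
have c0 : 0 <= c by rewrite ce ler0n.
pose C : R := 16 * c ^+ 4.
pose M := (Num.truncn (63 * C / e)).+1.
exists (9 * M)%N => s K Ns Ke; pose L := (K %/ 6)%N.
have KL : (6 * L <= K < 6 * L + 6)%N by rewrite /L; lia.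
have ML : (M <= L)%N by rewrite /L; lia.
pose t : R := 1 + L%:R / 63.
have t1 : 1 <= t by rewrite /t lerDl divr_ge0.
have t0 : 0 <= t by lra.
have et : C <= e * t.
  have : 63 * C / e < M%:R by exact: truncnS_gt.
  rewrite ltr_pdivrMr // => h; have : M%:R <= L%:R :> R by rewrite ler_nat.
  rewrite -(ler_pM2r e0) => h'; rewrite /t.
  by lra.
have st : (s.*2.+1)%:R <= c * t.
  have : (s.*2.+1 <= 18 * L + 18)%N by lia.
  rewrite -(ler_nat R) natrD natrM /t ce.
  by lra.
have geo : t ^+ 6 * 63 ^+ K <= 64 ^+ K.
  have -> : (64 : R) = (1 + 63^-1) * 63 by field.
  rewrite exprMn ler_wpM2r ?exprn_ge0 //.
  apply: (@le_trans _ _ ((1 + 63^-1) ^+ (6 * L)%N)); last first.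
    by apply: ler_weXn2l; [lra | case/andP: KL].
  rewrite mulnC exprM lerXn2r ?nnegrE ?exprn_ge0 //; try by lra.
  by apply: bernoulli_le; lra.
have p63 : 0 <= 63 ^+ K :> R by rewrite exprn_ge0.
apply: le_trans (ler_wpM2l (ltW e0) geo).
rewrite [X in _ <= X]mulrA ler_wpM2r //.
have h4 : (s.*2.+1)%:R ^+ 4 <= (c * t) ^+ 4.
  by rewrite lerXn2r ?nnegrE ?mulr_ge0.
apply: (@le_trans _ _ (C * t ^+ 4)).
  by rewrite /C -[X in _ <= X]mulrA -exprMn ler_wpM2l.
apply: (@le_trans _ _ (e * t * t ^+ 4)); first by rewrite ler_wpM2r ?exprn_ge0.
have -> : e * t ^+ 6 = e * t * t ^+ 4 * t by ring.
by rewrite ler_peMr // !mulr_ge0 ?exprn_ge0 // ltW.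
Qed.

Definition pstring_pair s : pred ((s.*2).-tuple bool * (s.*2).-tuple bool) :=
  fun x => pstring s x.1 && pstring s x.2.
Arguments pstring_pair : clear implicits.

(** The number of pairs of p-strings is at least [16^s / (2s+1)^4], and [64^K <= 16^s] because
    [3K <= 2s]; this is compared with [16 * 63^K]. *)
Lemma unclasped_fraction (R : realType) (e : R) : 0 < e -> exists N : nat, forall s : nat,
  (N <= s)%N ->
  #|[pred x in pstring_pair s | ~~ clasped s x.1 x.2]|%:R <= e * #|pstring_pair s|%:R.
Proof.
move=> e0; have [N hN] := geometric_beats_quartic e0; exists N => s Ns.
pose K := (s.*2 %/ 3)%N; have := hN s K Ns erefl; set q : R := (s.*2.+1)%:R => h.
pose D := #|[pred d : (s.*2).-tuple bool | pstring s d]|.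
have -> : #|pstring_pair s| = (D * D)%N.
  by rewrite -cardX; apply: eq_card.
have hD : (4 ^ s <= D * (s.*2.+1 * s.*2.+1))%N := pstring_card s.
have h64 : (64 ^ K <= D * D * s.*2.+1 ^ 4)%N.
  apply: (@leq_trans (4 ^ s * 4 ^ s)).
    by rewrite -expnD addnn (_ : 64 = 4 ^ 3)%N // -expnM leq_exp2l // /K; lia.
  apply: leq_trans (leq_mul hD hD) _; apply: eq_leq; ring.
have hb : (#|[pred x in pstring_pair s | ~~ clasped s x.1 x.2]| <= 63 ^ K * 16)%N.
  apply: leq_trans (unclasped_card s); apply: subset_leq_card.
  by apply/fintype.subsetP => x; rewrite !inE => /andP[].
have q0 : 0 < q ^+ 4 by rewrite exprn_gt0 // ltr0n.
rewrite -(ler_pM2r q0).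
have hbR : #|[pred x in pstring_pair s | ~~ clasped s x.1 x.2]|%:R <= 63 ^+ K * 16 :> R.
  by rewrite -natrX -natrM ler_nat.
have h64R : 64 ^+ K <= (D * D)%N%:R * q ^+ 4 :> R by rewrite -!natrX -natrM ler_nat.
apply: (@le_trans _ _ (63 ^+ K * 16 * q ^+ 4)); first by rewrite ler_wpM2r // ltW.
have -> : 63 ^+ K * 16 * q ^+ 4 = 16 * q ^+ 4 * 63 ^+ K by ring.
by apply: le_trans h _; rewrite -mulrA ler_wpM2l // ltW.
Qed.

(** On [P], [F] is at least [1 - d] minus the indicator of the complement of [G]; sum this bound. *)
Lemma average_near_1 (R : realType) (T : finType) (P G : pred T) (F : T -> R) (e d : R) :
  0 <= d -> (0 < #|P|)%N -> (forall x, P x -> 0 <= F x <= 1) ->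
  (forall x, P x -> G x -> 1 - d <= F x) ->
  #|[pred x in P | ~~ G x]|%:R <= e * #|P|%:R ->
  `|(\sum_(x | P x) F x) / #|P|%:R - 1| <= e + d.
Proof.
move=> d0 P0 F01 FG few.
have P0R : 0 < #|P|%:R :> R by rewrite ltr0n.
have card_sum (Q : pred T) : #|Q|%:R = \sum_(x | Q x) 1 :> R by rewrite sumr_const.
have up : \sum_(x | P x) F x <= #|P|%:R.
  by rewrite card_sum; apply: ler_sum => x /F01/andP[].
have low : #|P|%:R * (1 - d) - e * #|P|%:R <= \sum_(x | P x) F x.
  apply: le_trans (lerB (lexx _) few) _.
  have -> : #|[pred x in P | ~~ G x]|%:R = \sum_(x | P x) (if G x then 0 else 1) :> R.
    rewrite card_sum big_mkcond [RHS]big_mkcond; apply: eq_bigr => x _ /=.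
    by rewrite unfold_in /=; case: (P x); case: (G x).
  rewrite card_sum mulr_suml -sumrB; apply: ler_sum => x Px.
  have /andP[F0 _] := F01 x Px.
  by have := FG x Px; case: (G x) => [/(_ isT)|_]; lra.
rewrite distrC ger0_norm ?subr_ge0 ?ler_pdivrMr ?mul1r //.
rewrite lerBlDr -lerBlDl ler_pdivlMr //.
by lra.
Qed.

Section Probabilities.
Variables (R : realType) (s r : nat).
Hypothesis r0 : (0 < r)%N.

Lemma pstring_pair_gt0 : (0 < #|pstring_pair s|)%N.
Proof.
have := pstring_card s; rewrite lt0n => h; apply/eqP => e.
have D0 : #|[pred d : (s.*2).-tuple bool | pstring s d]| = 0%N.
  apply: eq_card0 => d; apply/negbTE/negP => pd.
  by have := card0_eq e (d, d); rewrite unfold_in /pstring_pair /= !(pd : pstring s d = true).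
by move: h; rewrite D0 mul0n leqn0 expn_eq0.
Qed.

Lemma pair_sum (F : (s.*2).-tuple bool -> (s.*2).-tuple bool -> R) :
  \sum_(U : (s.*2).-tuple bool | pstring s U) \sum_(W : (s.*2).-tuple bool | pstring s W) F U W
  = \sum_(x | pstring_pair s x) F x.1 x.2.
Proof. by rewrite pair_big. Qed.

Lemma clasped_alternating_nontrivial (U W : (s.*2).-tuple bool) (f : xinfo s r) :
  clasped s U W -> alternatingb s r U W f -> nontrivialb R s r U W f.
Proof.
move=> /claspedP[||a pU pW]; rewrite ?size_tuple // => /asboolP alt; apply/asboolP.
have [a0 _ _ _ _] := mpairP pU.
apply: (clasp_not_unlink (m0 := r.-1) _ _ _ pU pW); rewrite ?size_tuple ?prednK //.
by apply: (alternating_clasp r0 _ pW a0 alt); rewrite size_tuple.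
Qed.

(** If the link is an unlink, [clasp_not_unlink] forces equal crossing bits on axis copy 0 for each
    of the [r] circles. *)
Lemma clasped_trivial_card (U W : (s.*2).-tuple bool) : clasped s U W ->
  (#|[pred f : xinfo s r | ~~ nontrivialb R s r U W f]| * 2 ^ r <= #|xinfo s r|)%N.
Proof.
move=> /claspedP[||a pU pW]; rewrite ?size_tuple //.
have [a0 _ _ _ _] := mpairP pU.
apply: (random_clasp_card r0 _ pW a0); first by rewrite size_tuple.
move=> f /asboolPn/contrapT unl m mr; apply/eqP; apply: contraT => cl.
by have := clasp_not_unlink _ _ mr pU pW cl unl; rewrite !size_tuple => /(_ erefl erefl).
Qed.

Lemma prob_alt_average : prob_alt R r s =
  (\sum_(x | pstring_pair s x)
     #|[set f : xinfo s r | alternatingb s r x.1 x.2 f && nontrivialb R s r x.1 x.2 f]|%:R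
     / #|[set f : xinfo s r | alternatingb s r x.1 x.2 f]|%:R) / #|pstring_pair s|%:R.
Proof. by rewrite /prob_alt !pair_sum [X in _ / X]sumr_const. Qed.

Lemma xinfo_gt0 : (0 < #|xinfo s r|)%N.
Proof. by apply/card_gt0P; exists [ffun=> true]. Qed.

(** The number of crossing assignments is the same for all pairs of words, so the single quotient is
    an average of conditional probabilities. *)
Lemma prob_random_average : prob_random R r s =
  (\sum_(x | pstring_pair s x)
     #|[pred f : xinfo s r | nontrivialb R s r x.1 x.2 f]|%:R / #|xinfo s r|%:R)
  / #|pstring_pair s|%:R.
Proof.
rewrite /prob_random !pair_sum [X in _ / X]sumr_const.
have cT : #|(setT : set (xinfo s r))| = #|xinfo s r| by apply: eq_card => f; rewrite in_setT.
have X0 : #|xinfo s r|%:R != 0 :> R by rewrite pnatr_eq0 -lt0n xinfo_gt0.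
have P0 : #|pstring_pair s|%:R != 0 :> R by rewrite pnatr_eq0 -lt0n pstring_pair_gt0.
rewrite cT -mulr_suml -[X in _ / X = _]mulr_natr -mulrA -invfM; congr (_ / _).
apply: eq_bigr => x _; congr (_%:R); apply: eq_card => f.
by apply/idP/idP => [/set_mem//|h]; apply: mem_set.
Qed.

Lemma prob_alt_near_1 (e : R) : 0 < e ->
  #|[pred x in pstring_pair s | ~~ clasped s x.1 x.2]|%:R <= e * #|pstring_pair s|%:R ->
  `|prob_alt R r s - 1| <= e.
Proof.
move=> e0 few; rewrite prob_alt_average -[leRHS]addr0.
refine (@average_near_1 R _ (pstring_pair s) (fun x => clasped s x.1 x.2) (fun x => _) e 0 (lexx _) _ _ _ few).
- exact: pstring_pair_gt0.
- move=> x _; rewrite divr_ge0 //=.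
  set a := #|_|; set b := #|_|; have ab : (a <= b)%N.
    apply: subset_leq_card; apply/fintype.subsetP => f.
    by move=> /set_mem/andP[alt _]; apply: mem_set.
  (* For [b = 0] the quotient is 0, by the convention for division by zero. *)
  have [->|b0] := posnP b; first by rewrite invr0 mulr0.
  by rewrite ler_pdivrMr ?ltr0n // mul1r ler_nat.
- move=> [U W] /andP[pU pW] /= cl; rewrite subr0.
  have -> : #|[set f : xinfo s r | alternatingb s r U W f && nontrivialb R s r U W f]| =
      #|[set f : xinfo s r | alternatingb s r U W f]|.
    apply: eq_card => f; apply/idP/idP => /set_mem => [/andP[alt _]|alt]; apply: mem_set => //=.
    by rewrite alt; apply: clasped_alternating_nontrivial.
  rewrite divff // pnatr_eq0 -lt0n; apply/card_gt0P.
  have [f alt] := @alternating_exists s r U W (size_tuple _) (size_tuple _).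
  by exists f; apply: mem_set; apply/asboolP.
Qed.

Lemma prob_random_near_1 (e : R) : 0 < e ->
  #|[pred x in pstring_pair s | ~~ clasped s x.1 x.2]|%:R <= e * #|pstring_pair s|%:R ->
  `|prob_random R r s - 1| <= e + (2 ^+ r)^-1.
Proof.
move=> e0 few; rewrite prob_random_average.
have X0 : 0 < #|xinfo s r|%:R :> R by rewrite ltr0n xinfo_gt0.
refine (@average_near_1 R _ (pstring_pair s) (fun x => clasped s x.1 x.2) (fun x => _) e _ _ _ _ _ few).
- by rewrite invr_ge0 exprn_ge0.
- exact: pstring_pair_gt0.
- move=> x _; rewrite divr_ge0 //= ler_pdivrMr // mul1r ler_nat.
  exact: max_card.
- move=> [U W] _ /= cl; have := clasped_trivial_card cl.
  set b := #|_|; set X := #|_|; set a := #|_| => bX.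
  have ab : (a + b)%N = X := cardC [pred f : xinfo s r | nontrivialb R s r U W f].
  have XR : a%:R + b%:R = X%:R :> R by rewrite -natrD ab.
  have p2 : 0 < 2 ^+ r :> R by rewrite exprn_gt0.
  have bXR : b%:R <= (2 ^+ r)^-1 * X%:R :> R.
    by rewrite mulrC ler_pdivlMr // -natrX -natrM ler_nat.
  by rewrite ler_pdivlMr // mulrBl mul1r; lra.
Qed.

End Probabilities.

Theorem theorem4p5 (R : realType) :
  (* (i) alternating case: for each fixed r >= 1, limit as s -> oo *)
  (forall r : nat, (1 <= r)%N ->
     forall e : R, 0 < e -> exists N : nat, forall s : nat, (N <= s)%N ->
       `|prob_alt R r s - 1| < e) /\
  (* (ii) random crossings: limit as both s and r -> oo *)
  (forall e : R, 0 < e -> exists N : nat, forall r s : nat,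
       (N <= r)%N -> (N <= s)%N -> `|prob_random R r s - 1| < e).
Proof.
split=> [r r1 e e0|e e0]; have e2 : 0 < e / 2 by rewrite divr_gt0.
  have [N hN] := unclasped_fraction e2; exists N => s Ns.
  apply: le_lt_trans (prob_alt_near_1 r1 e2 (hN s Ns)) _.
  by rewrite ltr_pdivrMr // ltr_pMr // ltr1n.
(* For [r >= M] one has [2^r > r >= M > 2 / e], so the error [2^-r] is below the remaining
   [e / 2]. *)
have [N hN] := unclasped_fraction e2; pose M := (Num.truncn (2 / e)).+1.
exists (maxn N M) => r s; rewrite !geq_max => /andP[_ Mr] /andP[Ns _].
have r1 : (0 < r)%N by apply: leq_trans Mr.
apply: le_lt_trans (prob_random_near_1 r1 e2 (hN s Ns)) _.
suff : (2 ^+ r)^-1 < e / 2 by lra.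
rewrite -[e / 2]invrK invf_div ltf_pV2 ?posrE ?exprn_gt0 ?divr_gt0 //.
apply: (@lt_le_trans _ _ M%:R); first exact: truncnS_gt.
by rewrite -natrX ler_nat (leq_trans Mr) // ltnW // ltn_expl.
Qed.
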